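(* Let $\frac12<H_1<H_2<1$ with $H_2-H_1>\frac14$, and let $\gamma>0$ be a constant. Then there exists a sequence $T_n\to\infty$ such that for every $n$ the integral equation $$\gamma^2u^{1-2H_1}=\gamma^2h(u)u^{1-2H_1}+\int_0^{T_n}h(s)\,k(s,u)\,ds,\qquad u\in(0,T_n],$$ has a unique solution $h=h_{T_n}$ in the class of functions $h$ on $(0,T_n]$ with $u\mapsto h(u)u^{1/2-H_1}\in L^2[0,T_n]$.
   Context: For $0<s<t$ let $$K_{H_1,H_2}(t,s)=\beta_{H_2}s^{1/2-H_2}\int_s^t (t-u)^{1/2-H_1}u^{H_2-H_1}(u-s)^{H_2-3/2}\,du,$$ and $K_{H_1,H_2}(t,s)=0$ for $s\ge t$, where $\beta_{H}=\big(H(2H-1)/\mathrm B(H-\frac12,2-2H)\big)^{1/2}$ and $\mathrm B$ is the Beta function. $\partial_tK_{H_1,H_2}(t,s)$ denotes the derivative in the first variable. For $s,u>0$, $$k(s,u)=\int_0^{s\wedge u}\partial_sK_{H_1,H_2}(s,v)\,\partial_uK_{H_1,H_2}(u,v)\,dv.$$ (In the paper $\gamma=\gamma_{H_1}$ is the normalizing constant of the Molchan martingale of a fractional Brownian motion with index $H_1$.) *)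

(* Defs.v *)
From HB Require Import structures.
From mathcomp Require Import all_boot all_order all_algebra.
From mathcomp Require Import all_classical all_reals all_analysis.
Set Implicit Arguments. Unset Strict Implicit. Unset Printing Implicit Defensive.
Import Order.TTheory GRing.Theory Num.Theory.
Local Open Scope classical_set_scope.
Local Open Scope ring_scope.

Section Defs.
Context {R : realType}.
Notation mu := (@lebesgue_measure R).

Definition Beta (a b : R) : R :=
  Rintegral mu `]0, 1[ (fun x => x `^ (a - 1) * (1 - x) `^ (b - 1)).

Definition betaH (H : R) : R :=
  Num.sqrt (H * (2 * H - 1) / Beta (H - 2^-1) (2 - 2 * H)).

Definition KH (H1 H2 t s : R) : R :=
  if s < t then
    betaH H2 * s `^ (2^-1 - H2) *
    Rintegral mu `]s, t[
      (fun u => (t - u) `^ (2^-1 - H1) * u `^ (H2 - H1) * (u - s) `^ (H2 - 3 / 2))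
  else 0.

Definition dKH (H1 H2 t s : R) : R := derive1 (fun t' => KH H1 H2 t' s) t.

Definition kH (H1 H2 s u : R) : R :=
  Rintegral mu `]0, Order.min s u[ (fun v => dKH H1 H2 s v * dKH H1 H2 u v).

Definition oc0 (T : R) : set R := `]0, T].

Definition admissible (H1 T : R) (h : R -> R) : Prop :=
  measurable_fun `]0, T] h /\
  (\int[mu]_(u in (oc0 T)) (((h u * u `^ (2^-1 - H1)) ^+ 2)%:E) < +oo)%E.

(* h solves the integral equation on (0,T]; the integral is the Lebesgue
   integral, required to equal the (finite) left-hand side. *)
Definition solves_eq (H1 H2 gamma T : R) (h : R -> R) : Prop :=
  forall u, 0 < u <= T ->
    ((gamma ^+ 2 * u `^ (1 - 2 * H1))%:E =
     (gamma ^+ 2 * h u * u `^ (1 - 2 * H1))%:E +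
     \int[mu]_(s in (oc0 T)) ((h s * kH H1 H2 s u)%:E))%E.

End Defs.

(* Main.v *)
Require Import Defs.
From HB Require Import structures.
From mathcomp Require Import all_boot all_order all_algebra.
From mathcomp Require Import all_classical all_reals all_analysis.
From mathcomp Require Import measurable_realfun ring lra.
Import Order.TTheory GRing.Theory Num.Theory.
Import numFieldNormedType.Exports.
Local Open Scope classical_set_scope.
Local Open Scope ring_scope.

(** With [g u = h u * u^(1/2 - H1)] the equation becomes [g + K g = f] on
    L^2(0, T), where [f u = u^(1/2 - H1)] and K has the kernel
    [gamma^-2 (s u)^(H1 - 1/2) k(s, u) = int m(s, v) m(u, v) dv], with
    [m(s, v) = gamma^-1 s^(H1 - 1/2) d_s K_{H1,H2}(s, v)] for [0 < v < s <= T].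
    Being a Gram kernel it is positive: [<g, K g> >= 0].  So [1 + K] is
    injective and, for a small relaxation parameter [w], the iteration
    [g |-> (1 - w) g + w (f - K g)] contracts L^2.  Hence every [T > 0] works,
    and we take [T_n = n + 1].

    The condition [H2 - H1 > 1/4] makes the kernel square integrable in one
    variable for every value [u] of the other, with norm [M u <= c u^(1/2 - H2)].
    By Cauchy-Schwarz the iteration then converges at every point, dominated by
    an L^2 function, and the limit solves the equation at every [u], not just
    almost everywhere.  The bound on the kernel follows from
    [0 <= d_t K_{H1,H2}(t, s) <= C t^(H2 - H1) s^(1/2 - H2) (t - s)^(H2 - H1 - 1)],
    obtained by differentiating under the integral sign after the substitution
    [u = s + (t - s) x]. *)

(** * Integration *)

(** Tonelli gives measurability of the integrals of the positive and the negative part separately.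
    Hence no integrability of [f] is required, and parameter integrals are measurable even across
    points where they diverge. *)
Lemma measurable_Rintegral2 {d1 d2} {X : measurableType d1}
    {Y : measurableType d2} {R : realType}
    (mu : {sigma_finite_measure set Y -> \bar R}) (f : X * Y -> R) :
  measurable_fun setT f ->
  measurable_fun setT (fun x => \int[mu]_y f (x, y)).
Proof.
move=> mf; apply: measurableT_comp => //.
have mF : measurable_fun setT (EFin \o f) by exact/measurable_EFinP.
rewrite (_ : (fun x => _) = (fun x =>
  (\int[mu]_y (EFin \o f)^\+ (x, y) - \int[mu]_y (EFin \o f)^\- (x, y))%E)).
  apply: emeasurable_funB.
  - apply: (measurable_fun_fubini_tonelli_F (EFin \o f)^\+%E) => //.
    exact: measurable_funepos.
  - apply: (measurable_fun_fubini_tonelli_F (EFin \o f)^\-%E) => //.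
    exact: measurable_funeneg.
rewrite funeqE => x; rewrite (@integralE _ _ _ mu setT (fun y => (f (x, y))%:E)).
congr (_ - _)%E; apply: eq_integral => y _.
by rewrite !funeposE.
by rewrite !funenegE.

Qed.

(* No integrability of [f] is assumed: the integral of a non-integrable [f] is
   infinite, so that its [Rintegral] is 0. *)
Lemma integral_mul_Rintegral_ge0 {d} {X : measurableType d} {R : realType}
    (mu : {measure set X -> \bar R}) (f : X -> R) :
  measurable_fun setT f ->
  (0 <= \int[mu]_x (f x * \int[mu]_y f y)%:E)%E.
Proof.
move=> mf.
have mF : measurable_fun setT (EFin \o f) by exact/measurable_EFinP.
have [fi|nfi] := pselect (mu.-integrable setT (EFin \o f)).
  under eq_integral do rewrite EFinM.
  rewrite integralZr// -(@fineK _ (\int[mu]_x _)%E); last first.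
    exact: integrable_fin_num.
  by rewrite -EFinM lee_fin -expr2 sqr_ge0.
suff -> : \int[mu]_y f y = 0 by under eq_integral do rewrite mulr0; rewrite integral0.
rewrite /Rintegral; apply/eqP; apply/negPn/negP => ne0.
apply: nfi; apply/integrableP; split => //.
(* A nonzero [fine] comes from a finite value, and since [+oo - +oo] is [-oo], a finite difference
   forces both parts to be finite. *)
have : (\int[mu]_x (EFin \o f) x)%E \is a fin_num.
  by move: ne0; case: (\int[mu]_x _)%E => //=; rewrite eqxx.
rewrite -[X in (\int[mu]_x X x < _)%E]/(abse \o (EFin \o f)).
rewrite integralE fune_abse ge0_integralD//; last 2 first.
  exact: measurable_funepos.
  exact: measurable_funeneg.
have : (0 <= \int[mu]_x (EFin \o f)^\+ x)%E by apply: integral_ge0.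
have : (0 <= \int[mu]_x (EFin \o f)^\- x)%E by apply: integral_ge0.
case: (\int[mu]_x (EFin \o f)^\+ x)%E => [r| |]//.
all: case: (\int[mu]_x (EFin \o f)^\- x)%E => [s| |]//=.
by rewrite -EFinD ltry.
Qed.

Lemma measurable_Rintegral2_in {d1 d2} {X : measurableType d1}
    {Y : measurableType d2} {R : realType}
    (mu : {sigma_finite_measure set Y -> \bar R}) (D : set Y) (f : X * Y -> R) :
  measurable D -> measurable_fun setT f ->
  measurable_fun setT (fun x => \int[mu]_(y in D) f (x, y)).
Proof.
move=> mD mf; under eq_fun do rewrite Rintegral_mkcond.
rewrite (_ : (fun x => _) = fun x => \int[mu]_y (f (x, y) * \1_D y)); last first.
  rewrite funeqE => x; apply: eq_Rintegral => y _; rewrite patchE indicE.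
  by case: ifP => _ /=; rewrite ?mulr1 ?mulr0.
apply: (measurable_Rintegral2 mu (fun z : X * Y => f z * \1_D z.2)).
apply: measurable_funM => //.
by apply: (@measurableT_comp _ _ _ _ _ _ (\1_D : Y -> R)) => //; exact: measurable_indic.
Qed.

(** Cauchy-Schwarz in the form of a weighted Young inequality [y z <= c y^2 + e z^2]. The weights
    satisfy [4 c e = 1] and are balanced so that [c B^2 + e M^2 = B M]. *)
Lemma integral_mul_le {d} {X : measurableType d} {R : realType}
    (mu : {measure set X -> \bar R}) (g q : X -> R) (B M : R) :
  measurable_fun setT g -> measurable_fun setT q -> 0 < B -> 0 < M ->
  (\int[mu]_x (g x ^+ 2)%:E <= (B ^+ 2)%:E)%E ->
  (\int[mu]_x (q x ^+ 2)%:E <= (M ^+ 2)%:E)%E ->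
  (\int[mu]_x (`|g x| * `|q x|)%:E <= (B * M)%:E)%E.
Proof.
move=> mg mq B0 M0 gB qM.
pose c := M / (2 * B); pose e := B / (2 * M).
have c0 : 0 <= c by rewrite divr_ge0 ?mulr_ge0 ?ltW.
have e0 : 0 <= e by rewrite divr_ge0 ?mulr_ge0 ?ltW.
have mg2 : measurable_fun setT (fun x => (g x ^+ 2)%:E).
  by apply/measurable_EFinP; exact: measurable_funX.
have mq2 : measurable_fun setT (fun x => (q x ^+ 2)%:E).
  by apply/measurable_EFinP; exact: measurable_funX.
apply: (@le_trans _ _ (\int[mu]_x (c%:E * (g x ^+ 2)%:E + e%:E * (q x ^+ 2)%:E))%E).
  apply: ge0_le_integral => //.
  - apply/measurable_EFinP; apply: measurable_funM; exact: measurableT_comp.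
  - by apply: emeasurable_funD; apply: emeasurable_funM.
  move=> x _; rewrite -!EFinM -EFinD lee_fin.
  rewrite -(real_normK (num_real (g x))) -(real_normK (num_real (q x))).
  set y := `|g x|; set z := `|q x|.
  rewrite -subr_ge0 (_ : _ - _ = (M * y - B * z) ^+ 2 / (2 * B * M)).
    by rewrite divr_ge0 ?sqr_ge0// ?mulr_ge0 ?ltW.
  by rewrite /c /e; field; rewrite !gt_eqF.
rewrite ge0_integralD//; last 4 first.
- by move=> x _; rewrite -EFinM lee_fin mulr_ge0 ?sqr_ge0.
- by apply: emeasurable_funM.
- by move=> x _; rewrite -EFinM lee_fin mulr_ge0 ?sqr_ge0.
- by apply: emeasurable_funM.
rewrite !ge0_integralZl//; last 2 first.
- by move=> x _; rewrite lee_fin sqr_ge0.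
- by move=> x _; rewrite lee_fin sqr_ge0.
apply: (@le_trans _ _ (c%:E * (B ^+ 2)%:E + e%:E * (M ^+ 2)%:E)%E).
  by apply: leeD; apply: lee_wpmul2l; rewrite ?lee_fin.
rewrite -!EFinM -EFinD lee_fin le_eqVlt; apply/orP; left; apply/eqP.
by rewrite /c /e; field; rewrite !gt_eqF.
Qed.

(** * Equations with a Gram kernel *)

Section PositiveKernel.
Context {dX} {X : measurableType dX} {R : realType}.
Variable mu : {sigma_finite_measure set X -> \bar R}.
Variable m : X -> X -> R.
Hypothesis m_ge0 : forall s v, 0 <= m s v.
Hypothesis mm : measurable_fun setT (fun z : X * X => m z.1 z.2).

Definition gram (u s : X) : \bar R := (\int[mu]_v (m s v * m u v)%:E)%E.
(* 0 where [gram] is infinite, which happens on the diagonal; so is [kH]. *)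
Definition gramr (u s : X) : R := fine (gram u s).
Definition sqint (g : X -> R) : \bar R := (\int[mu]_x (g x ^+ 2)%:E)%E.
(** The operator acts on functions rather than on classes modulo null sets, because the equation has
    to hold at every point. *)
Definition gramop (g : X -> R) (u : X) : R := \int[mu]_s (g s * gramr u s).

Lemma gram_ge0 u s : (0 <= gram u s)%E.
Proof. by apply: integral_ge0 => v _; rewrite lee_fin mulr_ge0. Qed.

Lemma gramr_ge0 u s : 0 <= gramr u s.
Proof. exact: fine_ge0 (gram_ge0 _ _). Qed.

Lemma gramr_le u s : ((gramr u s)%:E <= gram u s)%E.
Proof.
by have := gram_ge0 u s; rewrite /gramr; case: (gram u s).
Qed.

Lemma gramC u s : gram u s = gram s u.
Proof. by apply: eq_integral => v _; rewrite mulrC. Qed.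

Lemma measurable_m1 v : measurable_fun setT (m ^~ v).
Proof.
by apply: (measurableT_comp mm (g := fun s => (s, v))); exact: measurable_fun_pair.
Qed.

Lemma measurable_m2 s : measurable_fun setT (m s).
Proof.
by apply: (measurableT_comp mm (g := fun v => (s, v))); exact: measurable_fun_pair.
Qed.

Lemma measurable_gram : measurable_fun setT (fun z : X * X => gram z.1 z.2).
Proof.
rewrite /gram.
pose F (z : (X * X) * X) := (m z.1.2 z.2 * m z.1.1 z.2)%:E.
apply: (measurable_fun_fubini_tonelli_F F).
  apply/measurable_EFinP; apply: measurable_funM.
  - apply: (measurableT_comp mm (g := fun z : (X * X) * X => (z.1.2, z.2))).
    apply: measurable_fun_pair => //.
    by apply: (measurableT_comp measurable_snd measurable_fst).
  - apply: (measurableT_comp mm (g := fun z : (X * X) * X => (z.1.1, z.2))).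
    apply: measurable_fun_pair => //.
    by apply: (measurableT_comp measurable_fst measurable_fst).
by move=> x; rewrite lee_fin mulr_ge0.
Qed.

Lemma measurable_gramr : measurable_fun setT (fun z : X * X => gramr z.1 z.2).
Proof. by apply: measurableT_comp measurable_gram. Qed.

Lemma measurable_gramr2 u : measurable_fun setT (gramr u).
Proof.
by apply: (measurableT_comp measurable_gramr (g := fun v => (u, v))); exact: measurable_fun_pair.
Qed.

Lemma measurable_gram2 u : measurable_fun setT (gram u).
Proof.
by apply: (measurableT_comp measurable_gram (g := fun v => (u, v))); exact: measurable_fun_pair.
Qed.

Lemma measurable_gramop g : measurable_fun setT g -> measurable_fun setT (gramop g).
Proof.
move=> mg; apply: (@measurable_Rintegral2 _ _ _ _ _ mu (fun z : X * X => g z.2 * gramr z.1 z.2)).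
apply: measurable_funM; last exact: measurable_gramr.
exact: measurableT_comp mg measurable_snd.
Qed.

(** [M u] plays the role of the L^2 norm of [gram u], expressed through its pairing with L^2
    functions, and [N] bounds the squared norm of [M], hence that of the operator. The pairing bound
    is required at every [u]; only finiteness in [s] is up to a null set. *)
Variables (M : X -> R) (N : R).
Hypothesis mM : measurable_fun setT M.
Hypothesis M_ge0 : forall u, 0 <= M u.
Hypothesis N_gt0 : 0 < N.
Hypothesis sqintM : (sqint M <= N%:E)%E.
Hypothesis gram_fin : forall u, {ae mu, forall s, (gram u s < +oo)%E}.
Hypothesis gram_bound : forall u (g : X -> R) B, measurable_fun setT g -> 0 < B ->
  (sqint g <= (B ^+ 2)%:E)%E ->
  (\int[mu]_s (`|g s|%:E * gram u s) <= (B * M u)%:E)%E.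

Lemma sqint_lty_bound (g : X -> R) : (sqint g < +oo)%E ->
  exists2 B, 0 < B & (sqint g <= (B ^+ 2)%:E)%E.
Proof.
have : (0 <= sqint g)%E by apply: integral_ge0 => x _; rewrite lee_fin sqr_ge0.
case: (sqint g) => // r; rewrite lee_fin => r0 _.
by exists (r + 1); [lra|rewrite lee_fin; nra].
Qed.

Lemma integrable_sqr (g : X -> R) : measurable_fun setT g -> (sqint g < +oo)%E ->
  mu.-integrable setT (fun x => (g x ^+ 2)%:E).
Proof.
move=> mg gfin; apply/integrableP; split.
  by apply/measurable_EFinP; exact: measurable_funX.
apply: le_lt_trans gfin; rewrite /sqint.
by under eq_integral do rewrite abse_EFin ger0_norm ?sqr_ge0//.
Qed.

Lemma integrable_mul_sqint (g h : X -> R) : measurable_fun setT g -> measurable_fun setT h ->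
  (sqint g < +oo)%E -> (sqint h < +oo)%E ->
  mu.-integrable setT (fun x => (g x * h x)%:E).
Proof.
move=> mg mh gfin hfin.
have ig := integrable_sqr _ mg gfin.
have ih := integrable_sqr _ mh hfin.
apply: (le_integrable measurableT _ _ (integrableD measurableT ig ih)).
  by apply/measurable_EFinP; exact: measurable_funM.
move=> x _; rewrite -EFinD !abse_EFin lee_fin.
rewrite [leRHS]ger0_norm ?addr_ge0 ?sqr_ge0// normrM.
rewrite -(real_normK (num_real (g x))) -(real_normK (num_real (h x))).
have := normr_ge0 (g x); have := normr_ge0 (h x); nra.
Qed.

Lemma integrable_gramop g u : measurable_fun setT g -> (sqint g < +oo)%E ->
  mu.-integrable setT (fun s => (g s * gramr u s)%:E).
Proof.
move=> mg gfin; apply/integrableP; split.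
  by apply/measurable_EFinP/measurable_funM => //; exact: measurable_gramr2.
have [B B0 gB] := sqint_lty_bound _ gfin.
apply: le_lt_trans (ltry (B * M u)); apply: le_trans (gram_bound u _ _ mg B0 gB).
apply: ge0_le_integral => //.
- apply/measurableT_comp/measurable_EFinP/measurable_funM => //; exact: measurable_gramr2.
- apply: emeasurable_funM; last exact: measurable_gram2.
  by apply/measurable_EFinP; exact: measurableT_comp.
move=> x _; rewrite abse_EFin normrM (ger0_norm (gramr_ge0 _ _)) ?EFinM// .
by rewrite lee_pmul// ?lee_fin ?gramr_ge0// gramr_le.
Qed.

Lemma gramop_le g u B : measurable_fun setT g -> 0 < B ->
  (sqint g <= (B ^+ 2)%:E)%E -> `|gramop g u| <= B * M u.
Proof.
move=> mg B0 gB.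
have gfin : (sqint g < +oo)%E by apply: le_lt_trans gB (ltry _).
have ig := integrable_gramop _ u mg gfin.
rewrite -lee_fin EFin_normr_Rintegral//.
apply: (le_trans (le_abse_integral _ _ _)) => //.
  by apply: measurable_int ig.
apply: le_trans (gram_bound u _ _ mg B0 gB).
apply: ge0_le_integral => //.
- apply/measurableT_comp/measurable_EFinP/measurable_funM => //; exact: measurable_gramr2.
- apply: emeasurable_funM; last exact: measurable_gram2.
  by apply/measurable_EFinP; exact: measurableT_comp.
move=> x _; rewrite abse_EFin normrM (ger0_norm (gramr_ge0 _ _)) ?EFinM// .
by rewrite lee_pmul// ?lee_fin ?gramr_ge0// gramr_le.
Qed.

Lemma sqint_gramop g B : measurable_fun setT g -> 0 < B ->
  (sqint g <= (B ^+ 2)%:E)%E -> (sqint (gramop g) <= (B ^+ 2 * N)%:E)%E.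
Proof.
move=> mg B0 gB.
apply: (@le_trans _ _ (\int[mu]_x ((B ^+ 2)%:E * (M x ^+ 2)%:E))%E).
  apply: ge0_le_integral => //.
  - by move=> x _; rewrite lee_fin sqr_ge0.
  - by apply/measurable_EFinP/measurable_funX; exact: measurable_gramop.
  - by apply/measurable_EFinP/measurable_funM => //; exact: measurable_funX.
  move=> x _; rewrite -EFinM lee_fin -exprMn -(real_normK (num_real (gramop _ _))).
  by rewrite lerXn2r ?nnegrE// ?gramop_le// (mulr_ge0 (ltW B0)).
rewrite ge0_integralZl//.
- by rewrite [in leRHS]EFinM lee_pmul// ?lee_fin ?sqr_ge0// integral_ge0// => x _; rewrite lee_fin sqr_ge0.
- by apply/measurable_EFinP; exact: measurable_funX.
- by move=> x _; rewrite lee_fin sqr_ge0.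
- by rewrite lee_fin sqr_ge0.
Qed.

Lemma sqint_gramop_lty g : measurable_fun setT g -> (sqint g < +oo)%E ->
  (sqint (gramop g) < +oo)%E.
Proof.
move=> mg gfin; have [B B0 gB] := sqint_lty_bound _ gfin.
exact: le_lt_trans (sqint_gramop _ _ mg B0 gB) (ltry _).
Qed.

(** * Factorization through the adjoint, and positivity *)

Definition adjop (g : X -> R) (v : X) : R := \int[mu]_s (g s * m s v).

Lemma measurable_adjop g : measurable_fun setT g -> measurable_fun setT (adjop g).
Proof.
move=> mg; apply: (@measurable_Rintegral2 _ _ _ _ _ mu (fun z : X * X => g z.2 * m z.2 z.1)).
apply: measurable_funM; first exact: measurableT_comp mg measurable_snd.
apply: (measurableT_comp mm (g := fun z : X * X => (z.2, z.1))).
exact: measurable_fun_pair.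
Qed.

Lemma measurable_gm (g : X -> R) u : measurable_fun setT g ->
  measurable_fun setT (fun z : X * X => (g z.1 * m z.1 z.2 * m u z.2)%:E).
Proof.
move=> mg; apply/measurable_EFinP/measurable_funM.
  apply: measurable_funM mm; exact: measurableT_comp mg measurable_fst.
exact: (measurableT_comp (measurable_m2 u) measurable_snd).
Qed.

Lemma integrable_gm g u : measurable_fun setT g -> (sqint g < +oo)%E ->
  (mu \x mu)%E.-integrable setT (fun z : X * X => (g z.1 * m z.1 z.2 * m u z.2)%:E).
Proof.
move=> mg gfin; apply/integrable12ltyP; first exact: measurable_gm.
have [B B0 gB] := sqint_lty_bound _ gfin.
apply: le_lt_trans (ltry (B * M u)); apply: le_trans (gram_bound u _ _ mg B0 gB).
rewrite le_eqVlt; apply/orP; left; apply/eqP/eq_integral => s _ /=.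
under eq_integral do rewrite -mulrA normrM (ger0_norm (mulr_ge0 _ _))// EFinM.
rewrite ge0_integralZl//.
- by apply/measurable_EFinP/measurable_funM; exact: measurable_m2.
- by move=> v _; rewrite lee_fin mulr_ge0.
Qed.

(** If [A] is the integral operator with kernel [m], then [adjop] is its adjoint and this says that
    [gramop] is [A] after its adjoint. Fubini applies because the absolute double integral equals
    the integral of [|g|] against [gram u], which [gram_bound] makes finite. *)
Lemma gramopE g u : measurable_fun setT g -> (sqint g < +oo)%E ->
  ((gramop g u)%:E = \int[mu]_v (m u v * adjop g v)%:E)%E.
Proof.
move=> mg gfin.
have ig := integrable_gm _ u mg gfin.
transitivity (\int[mu]_s (g s * gramr u s)%:E)%E.
  rewrite /gramop /Rintegral fineK//.
  exact: (integrable_fin_num _ (integrable_gramop _ _ mg gfin)).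
transitivity (\int[mu]_s \int[mu]_v (g s * m s v * m u v)%:E)%E.
  apply: ae_eq_integral => //.
  - by apply: measurable_int (integrable_gramop _ _ mg gfin).
  - exact: (measurable_fubini_F ig).
  (* Passing from [gramr] to [gram] costs only a null set of [s]. *)
  have := gram_fin u; apply: filterS => s gus _ /=.
  under eq_integral do rewrite -mulrA EFinM.
  rewrite integralZl//.
    rewrite EFinM -[(gramr _ _)%:E]/((fine (gram u s))%:E) fineK//.
    by rewrite ge0_fin_numE ?gram_ge0.
  apply/integrableP; split.
    by apply/measurable_EFinP/measurable_funM; exact: measurable_m2.
  by under eq_integral do rewrite abse_EFin (ger0_norm (mulr_ge0 _ _))//.
rewrite (Fubini ig).
apply: ae_eq_integral => //.
- exact: (measurable_fubini_G ig).
- by apply/measurable_EFinP/measurable_funM; [exact: measurable_m2|exact: measurable_adjop].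
have := ae_integrable2 ig; apply: filterS => v iv _ /=.
(* Fubini yields integrability of [g s * m s v * m u v] in [s]. Dividing by [m u v] gives that of
   [g s * m s v]; where [m u v] is 0, both sides vanish whatever value [adjop g v] takes. *)
have [muv0|muv0] := eqVneq (m u v) 0.
  by under eq_integral do rewrite muv0 mulr0; rewrite integral0 muv0 mul0r.
have igv : mu.-integrable setT (fun s => (g s * m s v)%:E).
  have := integrableZr measurableT (m u v)^-1 iv.
  by apply: eq_integrable => // s _ /=; rewrite -EFinM mulfK.
under eq_integral do rewrite EFinM.
by rewrite integralZr// muleC EFinM /adjop /Rintegral fineK// integrable_fin_num.
Qed.

(** The absolute bound behind the second exchange of integrals, in [gramop_pos]. With [|g|] in place
    of [g], Tonelli reduces it to [gram_bound]. *)
Lemma integral_adjop_le g u B : measurable_fun setT g -> 0 < B ->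
  (sqint g <= (B ^+ 2)%:E)%E ->
  (\int[mu]_v `|m u v * adjop g v|%:E <= (B * M u)%:E)%E.
Proof.
move=> mg B0 gB.
pose h := fun s => `|g s|.
have mh : measurable_fun setT h by exact: measurableT_comp.
have hB : (sqint h <= (B ^+ 2)%:E)%E.
  apply: le_trans gB; rewrite /sqint le_eqVlt; apply/orP; left; apply/eqP.
  by apply: eq_integral => x _; rewrite real_normK ?num_real.
apply: le_trans (gram_bound u _ _ mg B0 gB).
pose F (z : X * X) := (h z.1 * m z.1 z.2 * m u z.2)%:E.
have mF : measurable_fun setT F by exact: measurable_gm.
have F0 z : (0 <= F z)%E by rewrite /F lee_fin /h !mulr_ge0.
apply: (@le_trans _ _ (\int[mu]_v \int[mu]_s F (s, v)))%E.
  apply: ge0_le_integral => //.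
  - apply/measurable_EFinP/measurableT_comp => //.
    by apply/measurable_funM; [exact: measurable_m2|exact: measurable_adjop].
  - by apply: (measurable_fun_fubini_tonelli_G F).
  move=> v _; rewrite /F /=.
  under eq_integral do rewrite mulrC EFinM.
  have mhv : measurable_fun setT (fun s => h s * m s v).
    by apply: measurable_funM => //; exact: measurable_m1.
  rewrite ge0_integralZl//; last 3 first.
  - exact/measurable_EFinP.
  - by move=> s _; rewrite lee_fin mulr_ge0// /h.
  - by rewrite lee_fin.
  rewrite normrM ger0_norm// EFinM lee_pmul// ?lee_fin//.
  have [ig|nig] := pselect (mu.-integrable setT (fun s => (g s * m s v)%:E)).
    rewrite EFin_normr_Rintegral//.
    apply: (le_trans (le_abse_integral _ _ _)) => //; first exact: measurable_int ig.
    rewrite le_eqVlt; apply/orP; left; apply/eqP/eq_integral => s _.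
    by rewrite abse_EFin normrM [in RHS]/h (ger0_norm (m_ge0 _ _)).
  (* Without integrability [adjop g v] says nothing about [g], but the integral on the right is then
     infinite. *)
  suff -> : (\int[mu]_s (h s * m s v)%:E = +oo)%E by rewrite leey.
  apply/eqP; rewrite -leye_eq leNgt; apply/negP => hfin; apply: nig.
  apply/integrableP; split.
    by apply/measurable_EFinP/measurable_funM => //; exact: measurable_m1.
  by under eq_integral do rewrite abse_EFin normrM (ger0_norm (m_ge0 _ _)).
rewrite -(fubini_tonelli F)//.
rewrite le_eqVlt; apply/orP; left; apply/eqP/eq_integral => s _ /=.
under eq_integral do rewrite /F/= -mulrA EFinM.
rewrite ge0_integralZl//.
- by apply/measurable_EFinP/measurable_funM; exact: measurable_m2.
- by move=> v _; rewrite lee_fin mulr_ge0.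
- by rewrite lee_fin /h.
Qed.

(** By the factorization, the pairing of [g] with [gramop g] is the squared norm of [adjop g]. The
    exchange of integrals is allowed since the inner absolute integral is at most [B |g u| M u], a
    product of two L^2 functions. *)
Lemma gramop_pos g : measurable_fun setT g -> (sqint g < +oo)%E ->
  (0 <= \int[mu]_u (g u * gramop g u)%:E)%E.
Proof.
move=> mg gfin.
have [B B0 gB] := sqint_lty_bound _ gfin.
pose F (z : X * X) := (g z.1 * m z.1 z.2 * adjop g z.2)%:E.
have mA := measurable_adjop _ mg.
have mF : measurable_fun setT F.
  apply/measurable_EFinP/measurable_funM.
    apply: measurable_funM mm; exact: measurableT_comp mg measurable_fst.
  exact: (measurableT_comp mA measurable_snd).
have iu u : mu.-integrable setT (fun v => (m u v * adjop g v)%:E).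
  apply/integrableP; split.
    by apply/measurable_EFinP/measurable_funM => //; exact: measurable_m2.
  exact: le_lt_trans (integral_adjop_le _ u _ mg B0 gB) (ltry _).
have iF : (mu \x mu)%E.-integrable setT F.
  apply/integrable12ltyP => //.
  have igM : mu.-integrable setT (fun x => (g x * M x)%:E).
    apply: integrable_mul_sqint => //; exact: le_lt_trans sqintM (ltry _).
  have := integrableZl measurableT B (integrable_abse igM) => /integrable_lty.
  move=> /(_ measurableT); apply: le_lt_trans.
  apply: ge0_le_integral => //.
  - by move=> x _; apply: integral_ge0.
  - apply: (measurable_fun_fubini_tonelli_F (abse \o F)).
      exact: measurableT_comp.
    by move=> z; exact: abse_ge0.
  - by apply: emeasurable_funM => //; apply: measurableT_comp => //; exact: measurable_int igM.
  move=> u _; rewrite /F /=.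
  under eq_integral do rewrite -mulrA normrM EFinM.
  rewrite ge0_integralZl//; last first.
    apply/measurable_EFinP/measurableT_comp => //.
    by apply: measurable_funM => //; exact: measurable_m2.
  rewrite normrM (ger0_norm (M_ge0 _)) -EFinM mulrCA EFinM lee_pmul//.
    by apply: integral_ge0.
  exact: integral_adjop_le.
rewrite (_ : \int[mu]_u _ = \int[mu]_u \int[mu]_v F (u, v))%E; last first.
  apply: eq_integral => u _; rewrite EFinM gramopE// -integralZl//.
  by apply: eq_integral => v _; rewrite -EFinM mulrA.
rewrite (Fubini iF); apply: integral_ge0 => v _.
(* For fixed [v] the inner integral is formally [adjop g v] squared; the lemma also covers the [v]
   for which [g s * m s v] is not integrable. *)
apply: integral_mul_Rintegral_ge0.
by apply: measurable_funM => //; exact: measurable_m1.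
Qed.

(** * Injectivity *)

Lemma le_sqint_lty (k l : R) (f g h : X -> R) : measurable_fun setT f -> measurable_fun setT g ->
  measurable_fun setT h -> (forall x, `|h x| <= k * `|f x| + l * `|g x|) ->
  (sqint f < +oo)%E -> (sqint g < +oo)%E -> (sqint h < +oo)%E.
Proof.
move=> mf mg mh hfg fi gi.
have If := integrableZl measurableT (2 * k ^+ 2) (integrable_sqr _ mf fi).
have Ig := integrableZl measurableT (2 * l ^+ 2) (integrable_sqr _ mg gi).
have := integrable_lty measurableT (integrableD measurableT If Ig).
apply: le_lt_trans; apply: ge0_le_integral => //.
- by move=> x _; rewrite lee_fin sqr_ge0.
- by apply/measurable_EFinP; exact: measurable_funX.
- by move: (integrableD measurableT If Ig) => /measurable_int.
move=> x _; rewrite -!EFinM -EFinD lee_fin.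
rewrite -(real_normK (num_real (h x))) -(real_normK (num_real (f x))) -(real_normK (num_real (g x))).
apply: (@le_trans _ _ ((k * `|f x| + l * `|g x|) ^+ 2)).
  by rewrite lerXn2r ?nnegrE ?(le_trans _ (hfg x)).
rewrite -subr_ge0 [X in 0 <= X](_ : _ = (k * `|f x| - l * `|g x|) ^+ 2) ?sqr_ge0//; ring.
Qed.

Lemma gramopD (f g : X -> R) u : measurable_fun setT f -> measurable_fun setT g ->
  (sqint f < +oo)%E -> (sqint g < +oo)%E ->
  gramop (f \+ g) u = gramop f u + gramop g u.
Proof.
move=> mf mg fi gi; rewrite /gramop -RintegralD//; try exact: integrable_gramop.
by apply: eq_Rintegral => s _ /=; rewrite mulrDl.
Qed.

(** From [gramop g = - g] and positivity, the squared norm of [g] is at most 0, so [g] vanishes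
    almost everywhere. Then [gramop g] is 0 at every point, and the equation upgrades [g = 0] to
    every point. *)
Lemma gramop_ker (g : X -> R) : measurable_fun setT g -> (sqint g < +oo)%E ->
  (forall u, g u + gramop g u = 0) -> forall u, g u = 0.
Proof.
move=> mg gi g0.
have gpos := gramop_pos _ mg gi.
have sq0 : sqint g = 0%E.
  apply/eqP; rewrite eq_le; apply/andP; split; last first.
    by apply: integral_ge0 => x _; rewrite lee_fin sqr_ge0.
  rewrite -oppe_ge0 /sqint -integral_ge0N/=; last first.
    by move=> x _; rewrite lee_fin sqr_ge0.
  move: gpos; congr (_ <= _)%E; apply: eq_integral => u _.
  have -> : gramop g u = - g u by have := g0 u; lra.
  by rewrite mulrN.
have g_ae : ae_eq mu setT (EFin \o g) (cst 0%E).
  apply/ae_eq_integral_abs => //; first exact/measurable_EFinP.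
  have /(ae_eq_integral_abs mu measurableT) h : measurable_fun setT (fun x => (g x ^+ 2)%:E).
    by apply/measurable_EFinP; exact: measurable_funX.
  apply/(ae_eq_integral_abs mu measurableT); first exact/measurable_EFinP.
  have /h : (\int[mu]_x `|(g x ^+ 2)%:E| = 0)%E.
    by rewrite -[RHS]sq0; apply: eq_integral => x _; rewrite abse_EFin ger0_norm// sqr_ge0.
  apply: filterS => x /(_ I) /= [] /eqP; rewrite sqrf_eq0 => /eqP gx0 _.
  by rewrite gx0.
move=> u; have := g0 u; suff -> : gramop g u = 0 by rewrite addr0.
rewrite /gramop /Rintegral (@ae_eq_integral _ _ _ mu setT (cst 0%E))// ?integral0//.
  by apply: measurable_int (integrable_gramop _ u mg gi).
by move: g_ae; apply: filterS => x /(_ I) /= [] gx0 _; rewrite gx0 mul0r.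
Qed.

Lemma gramop_inj (g h : X -> R) : measurable_fun setT g -> measurable_fun setT h ->
  (sqint g < +oo)%E -> (sqint h < +oo)%E ->
  (forall u, g u + gramop g u = h u + gramop h u) -> g = h.
Proof.
move=> mg mh gi hi gh.
pose e u := g u - h u.
have me : measurable_fun setT e by exact: measurable_funB.
have ei : (sqint e < +oo)%E.
  by apply: (le_sqint_lty 1 1 g h) => // x; rewrite !mul1r ler_normB.
have e0 : forall u, e u = 0.
  apply: gramop_ker => // u.
  rewrite (_ : gramop e u = gramop g u - gramop h u); first by have := gh u; rewrite /e; lra.
  rewrite /gramop -RintegralB//; try exact: integrable_gramop.
  by apply: eq_Rintegral => s _ /=; rewrite mulrBl.
by rewrite funeqE => u; apply/eqP; rewrite -subr_eq0; apply/eqP; exact: e0.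
Qed.

(** * Relaxed Neumann iteration *)

Section Neumann.
Variable f : X -> R.
Hypothesis mf : measurable_fun setT f.
Hypothesis sqintf : (sqint f < +oo)%E.

(** This [w] minimizes [(1 - w)^2 + w^2 N], the bound on the squared contraction factor. The minimum
    is [1 - w], whence [q]. *)
Let w := (1 + N)^-1.
Let q := Num.sqrt (1 - w).

Let w_gt0 : 0 < w. Proof. by rewrite invr_gt0 addr_gt0. Qed.

Let w_lt1 : w < 1. Proof. by rewrite invf_lt1 ?addr_gt0// ltrDl. Qed.

Let wN : w * (1 + N) = 1. Proof. by rewrite mulVf// gt_eqF// addr_gt0. Qed.

Let q_sqr : q ^+ 2 = 1 - w. Proof. by rewrite sqr_sqrtr// subr_ge0 ltW. Qed.

Let q_gt0 : 0 < q. Proof. by rewrite sqrtr_gt0 subr_gt0. Qed.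

Let q_lt1 : q < 1. Proof. by have := q_sqr; have := q_gt0; have := w_gt0; nra. Qed.

Let w_le_q : 1 - w <= q. Proof. by have := q_sqr; have := q_gt0; have := q_lt1; nra. Qed.

Let step (d : X -> R) (u : X) : R := (1 - w) * d u - w * gramop d u.

Let measurable_step d : measurable_fun setT d -> measurable_fun setT (step d).
Proof.
move=> md; apply: measurable_funB; apply: measurable_funM => //.
exact: measurable_gramop.
Qed.

(* With [<d, K d> >= 0] and [|K d|^2 <= N |d|^2], the step
   satisfies [|(1-w) d - w K d|^2 <= ((1-w)^2 + w^2 N) |d|^2 = (1-w) |d|^2]. *)
Let sqint_step d B : measurable_fun setT d -> 0 < B ->
  (sqint d <= (B ^+ 2)%:E)%E -> (sqint (step d) <= ((q * B) ^+ 2)%:E)%E.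
Proof.
move=> md B0 dB.
have di : (sqint d < +oo)%E by apply: le_lt_trans dB (ltry _).
have mK := measurable_gramop _ md.
have Ki := sqint_gramop_lty _ md di.
have I1 := integrable_sqr _ md di.
have I2 := integrable_mul_sqint _ _ md mK di Ki.
have I3 := integrable_sqr _ mK Ki.
have J1 := integrableZl measurableT ((1 - w) ^+ 2) I1.
have J2 := integrableZl measurableT (- (2 * w * (1 - w))) I2.
have J3 := integrableZl measurableT (w ^+ 2) I3.
rewrite /sqint; under eq_integral.
  move=> x _.
  rewrite (_ : _%:E = (((1 - w) ^+ 2)%:E * (d x ^+ 2)%:E + ((- (2 * w * (1 - w)))%:E *
    (d x * gramop d x)%:E + (w ^+ 2)%:E * (gramop d x ^+ 2)%:E))%E); last first.
    by rewrite -!EFinM -!EFinD; congr EFin; rewrite /step; ring.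
  over.
rewrite integralD//; last exact: integrableD.
rewrite integralD// !integralZl//.
move: dB (gramop_pos _ md di) (sqint_gramop _ _ md B0 dB).
rewrite /sqint.
move: (integrable_fin_num measurableT I1) (integrable_fin_num measurableT I2)
  (integrable_fin_num measurableT I3).
case: (\int[mu]_x _)%E => // a _; case: (\int[mu]_x _)%E => // b _.
case: (\int[mu]_x _)%E => // c _; rewrite !lee_fin => aB b0 cB.
rewrite exprMn q_sqr.
have h1 : w ^+ 2 * c <= w ^+ 2 * (B ^+ 2 * N) by rewrite ler_wpM2l ?sqr_ge0.
have h2 : (1 - w) ^+ 2 * a <= (1 - w) ^+ 2 * B ^+ 2 by rewrite ler_wpM2l ?sqr_ge0.
have h3 : 0 <= w * (1 - w) * b by rewrite !mulr_ge0// ?subr_ge0 ltW.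
have h4 : (1 - w) ^+ 2 * B ^+ 2 + w ^+ 2 * (B ^+ 2 * N) = (1 - w) * B ^+ 2.
  rewrite (_ : w ^+ 2 * (B ^+ 2 * N) = w * (w * (1 + N) - w) * B ^+ 2); last by ring.
  by rewrite wN; ring.
lra.
Qed.

(** Increments of the iteration started at 0; their partial sums [g n] are the iterates. *)
Let d n := iter n step (fun u => w * f u).

Let measurable_d n : measurable_fun setT (d n).
Proof. by elim: n => [|n IH] /=; [exact: measurable_funM|exact: measurable_step]. Qed.

Let g n u := \sum_(k < n) d k u.

Let measurable_g n : measurable_fun setT (g n).
Proof. by apply: measurable_sum => k; exact: measurable_d. Qed.

(** The increments decay like [q^n] in L^2. By [gramop_le] this feeds a recursion at each point,
    [|d n.+1 u| <= q |d n u| + q^n B M u], so the series converges at every [u] under an L^2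
    majorant, and the equation passes to the limit everywhere. *)
Lemma gramop_surj : exists g : X -> R, [/\ measurable_fun setT g,
  (sqint g < +oo)%E & forall u, f u = g u + gramop g u].
Proof.
have [B B0 fB] := sqint_lty_bound _ sqintf.
have dB n : (sqint (d n) <= ((q ^+ n * B) ^+ 2)%:E)%E.
  elim: n => [|n IH].
    rewrite expr0 mul1r; apply: le_trans fB; apply: ge0_le_integral => //.
    - by move=> x _; rewrite lee_fin sqr_ge0.
    - by apply/measurable_EFinP/measurable_funX; exact: measurable_funM.
    - by apply/measurable_EFinP; exact: measurable_funX.
    move=> x _; rewrite lee_fin exprMn ler_piMl ?sqr_ge0//.
    by rewrite exprn_ile1// ltW.
  have := sqint_step _ _ (measurable_d n) (mulr_gt0 (exprn_gt0 n q_gt0) B0) IH.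
  by rewrite mulrA -exprS.
(* Both terms of the pointwise recursion have rate [q], which by itself gives only a bound of order
   [n q^n]. Any rate strictly between [q] and 1 absorbs the factor, once [(r - q) C = B]. *)
pose r := (1 + q) / 2.
have qr : q < r by rewrite /r; have := q_lt1; lra.
have r1 : r < 1 by rewrite /r; have := q_lt1; lra.
have r0 : 0 < r by exact: lt_trans q_gt0 qr.
pose C := B / (r - q).
have CE : (r - q) * C = B by rewrite /C mulrC divfK// gt_eqF// subr_gt0.
have C0 : 0 < C by rewrite divr_gt0// subr_gt0.
pose E u := `|f u| + C * M u.
have E0 u : 0 <= E u by rewrite addr_ge0// mulr_ge0// ltW.
have mE : measurable_fun setT E.
  by apply: measurable_funD; [exact: measurableT_comp|exact: measurable_funM].
have dE n u : `|d n u| <= r ^+ n * E u.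
  elim: n => [|n IH].
    rewrite expr0 mul1r /= normrM gtr0_norm//.
    apply: (@le_trans _ _ (`|f u|)); first by rewrite ler_piMl// ltW.
    by rewrite lerDl mulr_ge0// ltW.
  have Kd := gramop_le _ u _ (measurable_d n) (mulr_gt0 (exprn_gt0 n q_gt0) B0) (dB n).
  have qrn : q ^+ n <= r ^+ n by rewrite lerXn2r ?nnegrE// ltW.
  rewrite /= /step (le_trans (ler_normB _ _))// !normrM (gtr0_norm w_gt0) (@gtr0_norm _ (1 - w)) ?subr_gt0//.
  have h1 : w * `|gramop (d n) u| <= r ^+ n * B * M u.
    apply: (@le_trans _ _ (`|gramop (d n) u|)); first by rewrite ler_piMl// ltW.
    by apply: (le_trans Kd); rewrite !ler_wpM2r// ltW.
  have h2 : (1 - w) * `|d n u| <= q * (r ^+ n * E u).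
    by rewrite ler_pM// subr_ge0 ltW.
  have h3 : r ^+ n * B * M u <= (r - q) * (r ^+ n * E u).
    rewrite -CE (_ : _ * M u = (r - q) * (r ^+ n * (C * M u))); last by ring.
    rewrite ler_wpM2l ?subr_ge0 ?(ltW qr)//.
    by rewrite ler_pM2l ?exprn_gt0// /E lerDr.
  rewrite exprS -mulrA; lra.
(* The sum of the geometric majorants; it dominates all partial sums and lies in L^2 because [f] and
   [M] do. *)
pose G u := E u / (1 - r).
have r1' : 0 < 1 - r by rewrite subr_gt0.
have G0 u : 0 <= G u by rewrite divr_ge0// ltW.
have gG n u : `|g n u| <= G u.
  suff : `|g n u| <= G u * (1 - r ^+ n).
    by move=> /le_trans; apply; rewrite ler_piMr// gerBl exprn_ge0// ltW.
  elim: n => [|n IH]; first by rewrite /g big_ord0 normr0 expr0 subrr mulr0.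
  rewrite /g big_ord_recr/= (le_trans (ler_normD _ _))//.
  apply: (le_trans (lerD IH (dE n u))).
  have -> : E u = G u * (1 - r) by rewrite /G divfK// gt_eqF.
  rewrite exprS le_eqVlt; apply/orP; left; apply/eqP; ring.
have cg u : cvgn (g ^~ u).
  have -> : g ^~ u = series (fun n => d n u).
    by rewrite funeqE => n; rewrite /series /= /g big_mkord.
  apply: normed_cvg; apply: (@series_le_cvg _ _ (geometric (E u) r)) => //.
  - by move=> n /=; exact: normr_ge0.
  - by move=> n /=; rewrite mulr_ge0// exprn_ge0// ltW.
  - by move=> n /=; rewrite mulrC.
  - by apply: is_cvg_geometric_series; rewrite gtr0_norm.
pose gl u := limn (g ^~ u).
have ggl u : g ^~ u @ \oo --> gl u by exact: cg.
have mgl : measurable_fun setT gl by apply: (measurable_fun_cvg (h := g)).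
have glG u : `|gl u| <= G u.
  have h : `|g n u| @[n --> \oo] --> `|gl u| by apply: cvg_norm; exact: ggl.
  rewrite -(cvg_lim _ h)//; apply: limr_le; first by apply/cvg_ex; exists `|gl u|.
  by apply: nearW => n; exact: gG.
have Mi : (sqint M < +oo)%E by apply: le_lt_trans sqintM (ltry _).
have GE u : G u = (1 - r)^-1 * `|f u| + (C / (1 - r)) * `|M u|.
  by rewrite /G /E (ger0_norm (M_ge0 u)); ring.
have mG : measurable_fun setT G by apply: measurable_funM.
have gi n : (sqint (g n) < +oo)%E.
  apply: (@le_sqint_lty (1 - r)^-1 (C / (1 - r)) f M) => // u.
  by rewrite -GE.
have gli : (sqint gl < +oo)%E.
  by apply: (@le_sqint_lty (1 - r)^-1 (C / (1 - r)) f M) => // u; rewrite -GE.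
have Gi : (sqint G < +oo)%E.
  apply: (@le_sqint_lty (1 - r)^-1 (C / (1 - r)) f M) => // u.
  by rewrite -GE ger0_norm.
have di n : (sqint (d n) < +oo)%E by apply: le_lt_trans (dB n) (ltry _).
exists gl; split => // u.
(* This is the relaxed iteration [g n.+1 = (1 - w) g n + w (f - gramop (g n))], solved for the
   operator term. *)
have Kg n : w * gramop (g n) u = (1 - w) * g n u - g n.+1 u + w * f u.
  elim: n => [|n IH].
    rewrite /gramop (_ : (fun s => _) = cst 0); last first.
      by rewrite funeqE => s; rewrite /g big_ord0 mul0r.
    by rewrite Rintegral_cst// mul0r mulr0 /g big_ord_recr !big_ord0 /=; ring.
  have -> : g n.+1 = g n \+ d n by rewrite funeqE => s; rewrite /g big_ord_recr.
  rewrite gramopD// mulrDr IH /= [g n.+2 u]/g !big_ord_recr /= -/(g n u) /step.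
  rewrite (_ : g n.+1 u = g n u + d n u); last by rewrite /g big_ord_recr.
  by ring.
(* Dominated convergence at fixed [u]; the majorant [G s * gramr u s] is integrable because [G] is
   in L^2. *)
have Kcvg : gramop (g n) u @[n --> \oo] --> gramop gl u.
  have [|||||_ _] := @dominated_convergence _ _ _ mu setT measurableT
    (fun n s => (g n s * gramr u s)%:E) (fun s => (gl s * gramr u s)%:E)
    (fun s => (G s * gramr u s)%:E).
  - by move=> n; apply: measurable_int (integrable_gramop _ u (measurable_g n) (gi n)).
  - by apply: measurable_int (integrable_gramop _ u mgl gli).
  - apply: nearW => s _; apply: cvg_EFin; first exact: nearW.
    by apply: cvgMl; exact: ggl.
  - exact: integrable_gramop.
  - apply: nearW => s n _; rewrite abse_EFin lee_fin normrM (ger0_norm (gramr_ge0 _ _)).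
    by rewrite ler_wpM2r// gramr_ge0.
  move=> h; apply: (@fine_cvg _ _ _ _ (fun n => \int[mu]_s (g n s * gramr u s)%:E)%E).
  by rewrite /gramop /Rintegral fineK//; apply: integrable_fin_num => //; exact: integrable_gramop.
have h1 : w * gramop (g n) u @[n --> \oo] --> w * gramop gl u.
  by apply: cvgMr.
have h2 : (1 - w) * g n u - g n.+1 u + w * f u @[n --> \oo] -->
    (1 - w) * gl u - gl u + w * f u.
  apply: cvgD; last exact: cvg_cst.
  apply: cvgB; first exact: cvgMr.
  by have := ggl u; rewrite -cvg_shiftS.
have : w * gramop gl u = (1 - w) * gl u - gl u + w * f u.
  rewrite -(cvg_lim (@Rhausdorff R) h1) -(cvg_lim (@Rhausdorff R) h2).
  by under [in LHS]eq_fun do rewrite Kg.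
move=> h; apply: (mulfI (lt0r_neq0 w_gt0)); rewrite mulrDr h; ring.
Qed.

End Neumann.
End PositiveKernel.

(** * Integrals of powers *)

Section PowerIntegrals.
Context {R : realType}.
Notation mu := (@lebesgue_measure R).

Lemma measurable_fun_powR {d} {X : measurableType d} (D : set X) (f : X -> R) (p : R) :
  measurable_fun D f -> measurable_fun D (fun x => f x `^ p).
Proof.
move=> mf; apply: (@measurableT_comp _ _ _ _ _ _ (fun x : R => x `^ p)) => //.
Qed.

(** Lebesgue measure is [|c|] times its image under [x |-> c x + a]: the two agree on half-open
    intervals, and uniqueness does the rest. *)
Lemma ge0_integral_affine (f : R -> \bar R) (c a : R) : c != 0 ->
  measurable_fun setT f -> (forall x, 0 <= f x)%E ->
  (\int[mu]_x f x = `|c|%:E * \int[mu]_x f (c * x + a)%R)%E.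
Proof.
move=> c0 mf f0.
pose phi (x : measurableTypeR R) : measurableTypeR R := c * x + a.
have mphi : measurable_fun setT phi by apply: measurable_funD => //; exact: measurable_funM.
have c0' : 0 <= `|c| by exact: normr_ge0.
pose nu : {measure set (measurableTypeR R) -> \bar R} := pushforward mu phi.
have nuE (A : set (measurableTypeR R)) : measurable A ->
    mu A = mscale (NngNum c0') (nu mphi) A.
  move=> mA; apply: lebesgue_measure_unique => // _ [[x y]] _ <-.
  rewrite /= /mscale /= /pushforward.
  have [xy|yx] := leP x y; last first.
    rewrite set_itv_ge ?bnd_simp -?leNgt ?ltW//= preimage_set0 !measure0.
    by rewrite mule0.
  have [cp|cn|] := ltgtP c 0; last by move/eqP; rewrite (negbTE c0).
  (* A negative slope reverses the interval, so the closed end moves to the left. *)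
  - rewrite (_ : phi @^-1` `]x, y] = `[(y - a) / c, (x - a) / c[%classic); last first.
      apply/seteqP; split => z /=; rewrite !in_itv /= /phi => /andP[h1 h2].
        by rewrite ler_ndivrMr// ltr_ndivlMr// ?(mulrC z); lra.
      by move: h1 h2; rewrite ler_ndivrMr// ltr_ndivlMr// ?(mulrC z) => *; lra.
    rewrite !lebesgue_measure_itv/= !lte_fin ltr_ndivrMr// divfK//.
    rewrite ltrD2r; case: ifPn => _; last by rewrite mule0.
    by rewrite -!EFinB -EFinM ltr0_norm//; congr EFin; field.
  - rewrite (_ : phi @^-1` `]x, y] = `](x - a) / c, (y - a) / c]%classic); last first.
      apply/seteqP; split => z /=; rewrite !in_itv /= /phi => /andP[h1 h2].
        by rewrite ltr_pdivrMr// ler_pdivlMr// ?(mulrC z); lra.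
      by move: h1 h2; rewrite ltr_pdivrMr// ler_pdivlMr// ?(mulrC z) => *; lra.
    rewrite !lebesgue_measure_itv/= !lte_fin ltr_pdivrMr// divfK ?gt_eqF//.
    rewrite ltrD2r; case: ifPn => _; last by rewrite mule0.
    by rewrite -!EFinB -EFinM gtr0_norm//; congr EFin; field; rewrite gt_eqF.
have := @ge0_integral_pushforward _ _ _ _ _ phi mphi mu setT f measurableT mf (fun y _ => f0 y).
rewrite preimage_setT => <-.
have := @ge0_integral_mscale _ _ _ (nu mphi) setT measurableT (NngNum c0') f mf (fun y _ => f0 y).
move=> <-.
by apply: eq_measure_integral => A mA _; exact: nuE.
Qed.

(** The integrand may be singular at 0, so the fundamental theorem is applied on compact intervals
    exhausting []0, u]]. The primitive is nonnegative at the left end, and dropping that term leaves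
    a bound uniform in [n]. *)
Lemma integral_powR (p u : R) : p < 1 -> 0 < u ->
  (\int[mu]_(x in `]0%R, u[) (x `^ (- p))%:E <= (u `^ (1 - p) / (1 - p))%:E)%E.
Proof.
move=> p1 u0.
(* Dividing by [n + 2] rather than [n + 1] keeps the interval nondegenerate at [n = 0]. *)
pose A n : set R := `[u / n.+2%:R, u]%classic.
have p1' : 0 < 1 - p by rewrite subr_gt0.
have un n : 0 < u / n.+2%:R by rewrite divr_gt0.
have unu n : u / n.+2%:R < u.
  by rewrite ltr_pdivrMr// ltr_pMr// ltr1n.
pose F (x : R) := (1 - p)^-1 * x `^ (1 - p).
have dF (x : R) : 0 < x -> is_derive x 1 F (x `^ (- p)).
  move=> x0; rewrite /F.
  have h := is_deriveZ (1 - p)^-1 (is_derive1_powR (1 - p) x0).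
  apply: (is_derive_eq h).
  by rewrite /GRing.scale /= mulrA mulVf ?gt_eqF// mul1r; congr (_ `^ _); ring.
have cvgA := @ge0_nondecreasing_set_cvg_integral _ (measurableTypeR R) R A
  (fun x => (x `^ (- p))%:E) mu.
have mp D : measurable_fun D (fun x : R => (x `^ (- p))%:E).
  by apply: measurable_funTS; apply/measurable_EFinP; exact: measurable_powR.
apply: (@le_trans _ _ (\int[mu]_(x in \bigcup_i A i) (x `^ (- p))%:E)%E).
  apply: ge0_subset_integral => //.
  - by apply: bigcup_measurable => n _; exact: measurable_itv.
  - exact: mp.
  - by move=> x _; rewrite lee_fin powR_ge0.
  move=> x /=; rewrite in_itv /= => /andP[x0 xu].
  exists (Num.truncn (u / x)) => //=; rewrite /A /= in_itv /= (ltW xu) andbT.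
  rewrite ler_pdivrMr// mulrC -ler_pdivrMr//.
  have := truncnS_gt (u / x) => /ltW /le_trans; apply.
  by rewrite ler_nat.
have ndA : {homo A : n m / (n <= m)%N >-> (n <= m)%O}.
  move=> n m nm; rewrite subsetEset => x; rewrite /A /= !in_itv /= => /andP[h1 ->].
  rewrite andbT; apply: le_trans h1; rewrite ler_pM2l// lef_pV2 ?posrE ?ltr0n//.
  by rewrite ler_nat !ltnS.
have cA := cvgA ndA (fun n => measurable_itv _) (fun n => mp _)
  (fun n x _ => powR_ge0 _ _).
rewrite -(cvg_lim _ cA)//.
apply: lime_le.
  by apply/cvg_ex; eexists; exact: cA.
apply: nearW => n.
rewrite (@continuous_FTC2 _ _ F)//.
- rewrite -EFinB lee_fin /F mulrC.
  have : 0 <= (1 - p)^-1 * (u / n.+2%:R) `^ (1 - p).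
    by rewrite mulr_ge0 ?powR_ge0// invr_ge0 ltW.
  lra.
- apply: derivable_within_continuous => x; rewrite in_itv/= => /andP[ux _].
  by have := is_derive1_powR (- p) (lt_le_trans (un n) ux).
- split.
  + move=> x; rewrite in_itv/= => /andP[ux _].
    by have := dF _ (lt_trans (un n) ux).
  + apply: cvg_at_right_filter; apply: differentiable_continuous.
    by apply/derivable1_diffP; have := dF _ (un n).
  + apply: cvg_at_left_filter; apply: differentiable_continuous.
    by apply/derivable1_diffP; have := dF _ u0.
- move=> x; rewrite in_itv/= => /andP[ux _].
  by rewrite derive1E; have := dF _ (lt_trans (un n) ux) => -[_ ->].
Qed.

Lemma integral_powR_left (p y z : R) : p < 1 -> y < z ->
  (\int[mu]_(x in `]y, z[) ((x - y) `^ (- p))%:E <=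
   ((z - y) `^ (1 - p) / (1 - p))%:E)%E.
Proof.
move=> p1 yz; apply: (le_trans _ (integral_powR _ _ p1 (_ : 0 < z - y))); last by rewrite subr_gt0.
rewrite integral_mkcond (@ge0_integral_affine _ 1 y)//; last 2 first.
- apply/(measurable_restrictT _ _).1 => //; apply/measurable_EFinP.
  by apply: measurable_fun_powR; exact: measurable_funB.
- by move=> x; rewrite patchE; case: ifPn => // _; rewrite lee_fin powR_ge0.
rewrite normr1 mul1e [leRHS]integral_mkcond le_eqVlt; apply/orP; left; apply/eqP.
apply: eq_integral => x _; rewrite !patchE !mem_setE !in_itv/= mul1r.
by rewrite ltrDr ltrBrDr addrK.
Qed.

Lemma integral_powR_right (p y z : R) : p < 1 -> y < z ->
  (\int[mu]_(x in `]y, z[) ((z - x) `^ (- p))%:E <=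
   ((z - y) `^ (1 - p) / (1 - p))%:E)%E.
Proof.
move=> p1 yz; apply: (le_trans _ (integral_powR _ _ p1 (_ : 0 < z - y))); last by rewrite subr_gt0.
rewrite integral_mkcond (@ge0_integral_affine _ (-1) z)//; last 2 first.
- apply/(measurable_restrictT _ _).1 => //; apply/measurable_EFinP.
  by apply: measurable_fun_powR; exact: measurable_funB.
- by move=> x; rewrite patchE; case: ifPn => // _; rewrite lee_fin powR_ge0.
rewrite normrN1 mul1e [leRHS]integral_mkcond le_eqVlt; apply/orP; left; apply/eqP.
apply: eq_integral => x _; rewrite !patchE !mem_setE !in_itv/= mulN1r.
rewrite (_ : z - (- x + z) = x); last by ring.
by congr (if _ then _ else _); apply/andP/andP => -[*]; split; lra.
Qed.

Lemma powR_anti (x y p : R) : 0 < x -> x <= y -> 0 <= p -> y `^ (- p) <= x `^ (- p).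
Proof.
move=> x0 xy p0; have y0 := lt_le_trans x0 xy.
rewrite !powRN lef_pV2 ?posrE ?powR_gt0//.
by apply: ge0_ler_powR => //; rewrite nnegrE ltW.
Qed.

(** At each [x] one of [x - y] and [z - x] is at least half the length, so one factor is at most its
    value there, [e] or [c]. Adding the two resulting bounds avoids cutting the integral at the
    midpoint. *)
Lemma integral_beta_le (p q y z : R) : 0 <= p < 1 -> 0 <= q < 1 -> y < z ->
  (\int[mu]_(x in `]y, z[) ((x - y) `^ (- p) * (z - x) `^ (- q))%:E <=
   (((2 `^ q) / (1 - p) + (2 `^ p) / (1 - q)) * (z - y) `^ (1 - p - q))%:E)%E.
Proof.
move=> /andP[p0 p1] /andP[q0 q1] yz.
have zy : 0 < z - y by rewrite subr_gt0.
have zy2 : 0 < (z - y) / 2 by rewrite divr_gt0.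
pose c := ((z - y) / 2) `^ (- q); pose e := ((z - y) / 2) `^ (- p).
have mx : measurable_fun setT (fun x : R => (x - y) `^ (- p)).
  by apply: measurable_fun_powR; exact: measurable_funB.
have mz : measurable_fun setT (fun x : R => (z - x) `^ (- q)).
  by apply: measurable_fun_powR; exact: measurable_funB.
have mx' : measurable_fun `]y, z[ (fun x : R => ((x - y) `^ (- p))%:E).
  by apply/measurable_EFinP; exact: measurable_funTS.
have mz' : measurable_fun `]y, z[ (fun x : R => ((z - x) `^ (- q))%:E).
  by apply/measurable_EFinP; exact: measurable_funTS.
apply: (@le_trans _ _ (\int[mu]_(x in `]y, z[)
    (c%:E * ((x - y) `^ (- p))%:E + e%:E * ((z - x) `^ (- q))%:E))%E).
  apply: ge0_le_integral => //.
  - by move=> x _; rewrite lee_fin mulr_ge0 ?powR_ge0.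
  - by apply/measurable_EFinP/measurable_funTS; exact: measurable_funM.
  - by apply: emeasurable_funD; apply: emeasurable_funM.
  move=> x /=; rewrite in_itv /= => /andP[yx xz].
  rewrite -!EFinM -EFinD lee_fin.
  have c0 : 0 <= c by exact: powR_ge0.
  have e0 : 0 <= e by exact: powR_ge0.
  have a0 := powR_ge0 (x - y) (- p); have b0 := powR_ge0 (z - x) (- q).
  have [h|h] := leP (x - y) ((z - y) / 2).
    have : (z - x) `^ (- q) <= c by apply: powR_anti => //; lra.
    nra.
  have : (x - y) `^ (- p) <= e by apply: powR_anti => //; lra.
  nra.
rewrite ge0_integralD//; last 4 first.
- by move=> x _; rewrite -EFinM lee_fin mulr_ge0 ?powR_ge0.
- by apply: emeasurable_funM.
- by move=> x _; rewrite -EFinM lee_fin mulr_ge0 ?powR_ge0.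
- by apply: emeasurable_funM.
rewrite !ge0_integralZl//; try by rewrite lee_fin powR_ge0.
all: try by move=> x _; rewrite lee_fin powR_ge0.
apply: (@le_trans _ _ (c%:E * ((z - y) `^ (1 - p) / (1 - p))%:E +
  e%:E * ((z - y) `^ (1 - q) / (1 - q))%:E)%E).
  apply: leeD; apply: lee_wpmul2l; rewrite ?lee_fin ?powR_ge0//.
    exact: integral_powR_left.
  exact: integral_powR_right.
rewrite -!EFinM -EFinD lee_fin.
have zyn : z - y != 0 by rewrite gt_eqF.
have -> : c = 2 `^ q * (z - y) `^ (- q).
  by rewrite /c powRM ?invr_ge0// ?(ltW zy)// -[2^-1]powR_inv1// -powRrM mulN1r opprK mulrC.
have -> : e = 2 `^ p * (z - y) `^ (- p).
  by rewrite /e powRM ?invr_ge0// ?(ltW zy)// -[2^-1]powR_inv1// -powRrM mulN1r opprK mulrC.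
have h1 : (z - y) `^ (1 - p - q) = (z - y) `^ (- q) * (z - y) `^ (1 - p).
  by rewrite -powRD ?zyn ?implybT//; congr (_ `^ _); ring.
have h2 : (z - y) `^ (1 - p - q) = (z - y) `^ (- p) * (z - y) `^ (1 - q).
  by rewrite -powRD ?zyn ?implybT//; congr (_ `^ _); ring.
rewrite mulrDl le_eqVlt; apply/orP; left; apply/eqP; congr (_ + _).
  by rewrite h1; ring.
by rewrite h2; ring.
Qed.

End PowerIntegrals.

(** * The derivative of K *)

Section Derivatives.
Context {R : realType}.

Lemma is_derive_affine (c e t : R) : is_derive t 1 (fun x : R => c * x + e) c.
Proof.
have h := is_deriveD (is_deriveZ c (is_derive_id t (1 : R))) (is_derive_cst e t (1 : R)).
apply: (is_derive_eq h).
by rewrite addr0 /GRing.scale /= mulr1.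
Qed.

Lemma is_derive_powR_affine (p c e t : R) : 0 < c * t + e ->
  is_derive t 1 (fun x : R => (c * x + e) `^ p) (p * (c * t + e) `^ (p - 1) * c).
Proof.
move=> pos.
exact: (@is_derive1_comp R (fun x => x `^ p) (fun x => c * x + e) t _ _
  (is_derive1_powR p pos) (is_derive_affine c e t)).
Qed.

End Derivatives.

Section Kernel.
Context {R : realType}.
Notation mu := (@lebesgue_measure R).
Variables H1 H2 : R.
Hypotheses (h1 : 2^-1 < H1) (h12 : H1 < H2) (h2 : H2 < 1).

Ltac hlra := (have := h1; have := h12; have := h2; move=> ? ? ?; lra).

Definition wgt (x : R) : R := (1 - x) `^ (2^-1 - H1) * x `^ (H2 - 3 / 2).
Definition wint : R := \int[mu]_(x in `]0, 1[) wgt x.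
(** What remains of the integral in [KH] after the substitution [u = s + (t - s) x] and removal of
    the factor [(t - s)^(H2 - H1)]. The domain no longer depends on [t]; [Jfun] is the formal
    derivative in [t]. *)
Definition Ifun (t s : R) : R :=
  \int[mu]_(x in `]0, 1[) (wgt x * (s + (t - s) * x) `^ (H2 - H1)).
Definition Jfun (t s : R) : R := \int[mu]_(x in `]0, 1[)
  (wgt x * ((H2 - H1) * (s + (t - s) * x) `^ (H2 - H1 - 1) * x)).

Lemma wgt_ge0 x : 0 <= wgt x.
Proof. by rewrite mulr_ge0 ?powR_ge0. Qed.

Lemma measurable_wgt D : measurable_fun D wgt.
Proof.
by apply: measurable_funM; apply: measurable_fun_powR => //; exact: measurable_funB.
Qed.

Lemma integrable_wgt : mu.-integrable `]0, 1[ (EFin \o wgt).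
Proof.
apply/integrableP; split; first by apply/measurable_EFinP; exact: measurable_wgt.
have p01 : 0 <= 3 / 2 - H2 < 1 by apply/andP; split; hlra.
have q01 : 0 <= H1 - 2^-1 < 1 by apply/andP; split; hlra.
apply: le_lt_trans (le_lt_trans (integral_beta_le _ _ 0 1 p01 q01 ltr01) (ltry _)).
rewrite le_eqVlt; apply/orP; left; apply/eqP/eq_integral => x _ /=.
rewrite ger0_norm ?wgt_ge0// subr0 /wgt mulrC.
by congr (_ `^ _ * _ `^ _)%:E; ring.
Qed.

Lemma wint_ge0 : 0 <= wint.
Proof. by apply: Rintegral_ge0 => x _; exact: wgt_ge0. Qed.

Lemma wgt_mul_bounds (g : R -> R) (k : R) : measurable_fun setT g ->
  (forall x, 0 < x < 1 -> 0 <= g x <= k) ->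
  [/\ mu.-integrable `]0, 1[ (fun x => (wgt x * g x)%:E),
      0 <= \int[mu]_(x in `]0, 1[) (wgt x * g x) &
      \int[mu]_(x in `]0, 1[) (wgt x * g x) <= k * wint].
Proof.
move=> mg gk.
have ik : mu.-integrable `]0, 1[ (EFin \o (fun x => k * wgt x)).
  exact: (integrableZl _ k integrable_wgt).
have ig : mu.-integrable `]0, 1[ (fun x => (wgt x * g x)%:E).
  apply: (le_integrable _ _ _ ik) => //.
    apply/measurable_EFinP; apply: measurable_funM; first exact: measurable_wgt.
    exact: measurable_funTS.
  move=> x /=; rewrite in_itv /= => /gk/andP[g0 gk'].
  have w0 := wgt_ge0 x.
  have k0 := le_trans g0 gk'.
  rewrite lee_fin (ger0_norm (mulr_ge0 w0 g0)) (ger0_norm (mulr_ge0 k0 w0)).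
  by rewrite mulrC ler_wpM2r.
split => //.
  apply: Rintegral_ge0 => x /=; rewrite in_itv /= => /gk/andP[g0 _].
  by rewrite mulr_ge0 ?wgt_ge0.
rewrite /wint -RintegralZl//; last exact: integrable_wgt.
apply: le_Rintegral => //.
move=> x /=; rewrite in_itv /= => /gk/andP[g0 gk'].
by rewrite mulrC ler_wpM2r ?wgt_ge0.
Qed.

Lemma itv_pt (s t x : R) : s < t -> 0 < x < 1 -> s < s + (t - s) * x < t.
Proof. by move=> st /andP[x0 x1]; apply/andP; split; nra. Qed.

Lemma measurable_pt (s t p : R) :
  measurable_fun setT (fun x : R => (s + (t - s) * x) `^ p).
Proof.
by apply: measurable_fun_powR; apply: measurable_funD => //; exact: measurable_funM.
Qed.

Lemma Ifun_bounds (t s : R) : 0 < s < t ->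
  [/\ mu.-integrable `]0, 1[ (fun x => (wgt x * (s + (t - s) * x) `^ (H2 - H1))%:E),
      0 <= Ifun t s & Ifun t s <= t `^ (H2 - H1) * wint].
Proof.
move=> /andP[s0 st]; apply: wgt_mul_bounds; first exact: measurable_pt.
move=> x x01; rewrite powR_ge0 /=; have /andP[h3 h4] := itv_pt s t x st x01.
by apply: ge0_ler_powR; rewrite ?nnegrE; hlra.
Qed.

(** Dropping [s] from the base increases the negative power, and the extra factor [x] then turns
    [x^(H2 - H1 - 1)] into [x^(H2 - H1) <= 1]. The bound contains no negative power of [s] alone. *)
Lemma Jfun_bounds (t s : R) : 0 < s < t ->
  0 <= Jfun t s <= (H2 - H1) * (t - s) `^ (H2 - H1 - 1) * wint.
Proof.
move=> /andP[s0 st].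
have [||_ -> ->//] := wgt_mul_bounds
  (fun x => (H2 - H1) * (s + (t - s) * x) `^ (H2 - H1 - 1) * x)
  ((H2 - H1) * (t - s) `^ (H2 - H1 - 1)).
  apply: measurable_funM => //; apply: measurable_funM => //; exact: measurable_pt.
move=> x /andP[x0 x1].
have a0 : 0 <= H2 - H1 by hlra.
rewrite mulr_ge0 ?(ltW x0) ?mulr_ge0 ?powR_ge0//=.
rewrite -mulrA ler_wpM2l//.
have tsx : 0 < (t - s) * x by rewrite mulr_gt0// subr_gt0.
have h : (s + (t - s) * x) `^ (H2 - H1 - 1) <= ((t - s) * x) `^ (H2 - H1 - 1).
  by rewrite (_ : H2 - H1 - 1 = - (1 - H2 + H1)); [apply: powR_anti; hlra|ring].
apply: (le_trans (ler_wpM2r (ltW x0) h)).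
rewrite powRM ?subr_ge0 ?(ltW st) ?(ltW x0)// -mulrA ler_piMr ?powR_ge0//.
rewrite mulrC mulr_powRB1 ?(ltW x0)//; last hlra.
by have := @ger_powR R x _ 0 (H2 - H1) a0; rewrite powRr0; apply; hlra.
Qed.

Lemma KHE (t s : R) : 0 < s < t ->
  KH H1 H2 t s = betaH H2 * s `^ (2^-1 - H2) * ((t - s) `^ (H2 - H1) * Ifun t s).
Proof.
move=> /andP[s0 st]; rewrite /KH st; congr (_ * _).
have ts : 0 < t - s by rewrite subr_gt0.
have [iI I0 _] := Ifun_bounds t s (introT andP (conj s0 st)).
pose G := fun x => (wgt x * (s + (t - s) * x) `^ (H2 - H1))%:E.
rewrite /Rintegral integral_mkcond.
rewrite (ge0_integral_affine _ (t - s) s)//; last 3 first.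
- by rewrite gt_eqF.
- apply/(measurable_restrictT _ _).1 => //; apply/measurable_EFinP.
  apply: measurable_funM; [apply: measurable_funM|]; apply: measurable_fun_powR => //.
  + exact: measurable_funB.
  + exact: measurable_funB.
- by move=> x; rewrite patchE; case: ifPn => // _; rewrite lee_fin !mulr_ge0 ?powR_ge0.
(* The two singular factors scale with total exponent [H2 - H1 - 1]; the Jacobian [t - s] raises it
   to [H2 - H1]. *)
rewrite (_ : (\int[mu]_x _)%E = (((t - s) `^ (H2 - H1 - 1))%:E * \int[mu]_(x in `]0%R, 1%R[) G x)%E).
  rewrite gtr0_norm// muleA -EFinM mulr_powRB1 ?(ltW ts)//; last hlra.
  rewrite -[X in fine (_ * X)%E](@fineK _ (\int[mu]_(x in _) G x)%E)//.
  exact: integrable_fin_num iI.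
rewrite -ge0_integralZl//; last 3 first.
- by apply: measurable_int iI.
- by move=> x _; rewrite lee_fin mulr_ge0 ?wgt_ge0 ?powR_ge0.
- by rewrite lee_fin powR_ge0.
rewrite [RHS]integral_mkcond; apply: eq_integral => x _.
rewrite !patchE !mem_setE !in_itv /=.
rewrite -[X in (X < _) && _]add0r ltrD2r pmulr_rgt0//.
rewrite -ltrBrDr -[X in _ && (_ < X)]mulr1 ltr_pM2l//.
case: ifPn => // /andP[x0 x1].
rewrite /G -EFinM; congr EFin.
rewrite (_ : t - ((t - s) * x + s) = (t - s) * (1 - x)); last by ring.
rewrite (_ : (t - s) * x + s - s = (t - s) * x); last by ring.
rewrite [_ * x + s]addrC !powRM ?(ltW ts) ?(ltW x0) ?subr_ge0 ?(ltW x1)//.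
have -> : (t - s) `^ (H2 - H1 - 1) = (t - s) `^ (2^-1 - H1) * (t - s) `^ (H2 - 3 / 2).
  by rewrite -powRD ?(gt_eqF ts) ?implybT//; congr (_ `^ _); field.
by rewrite /wgt; ring.
Qed.

(** The product rule applied to [KHE]. Unlike [dKH], this formula is visibly measurable in both
    variables jointly. *)
Definition Dfun (t s : R) : R := betaH H2 * s `^ (2^-1 - H2) *
  ((H2 - H1) * (t - s) `^ (H2 - H1 - 1) * Ifun t s + (t - s) `^ (H2 - H1) * Jfun t s).

Lemma is_derive_Ifun (t s : R) : 0 < s < t ->
  is_derive t 1 (Ifun ^~ s) (Jfun t s).
Proof.
move=> /andP[s0 st].
pose f (t' x : R) := wgt x * (s + (t' - s) * x) `^ (H2 - H1).
have a0 : 0 < H2 - H1 by hlra.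
have df (t' x : R) : s < t' -> 0 < x < 1 -> is_derive t' 1 (f ^~ x)
   (wgt x * ((H2 - H1) * (s + (t' - s) * x) `^ (H2 - H1 - 1) * x)).
  move=> st' x01; have /andP[h3 h4] := itv_pt s t' x st' x01.
  have E (y : R) : s + (y - s) * x = x * y + (s - x * s) by ring.
  rewrite (_ : f ^~ x = (fun y => wgt x * (x * y + (s - x * s)) `^ (H2 - H1))); last first.
    by rewrite funeqE => y; rewrite /f E.
  have pos : 0 < x * t' + (s - x * s) by rewrite -E; hlra.
  rewrite E.
  exact: (is_derive_eq (is_deriveZ (wgt x) (is_derive_powR_affine (H2 - H1) x _ t' pos))).
have tI : `]s, t + 1[%classic t by rewrite /= in_itv /= st ltrDl ltr01.
have c1 (t' : R) : `]s, t + 1[%classic t' -> mu.-integrable `]0, 1[ (EFin \o f t').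
  rewrite /= in_itv /= => /andP[st' _].
  by have [] := Ifun_bounds t' s (introT andP (conj s0 st')).
have c2 (t' x : R) : `]s, t + 1[%classic t' -> `]0, 1[%classic x -> derivable (f^~ x) t' 1.
  rewrite /= !in_itv /= => /andP[st' _] x01.
  by have := df t' x st' x01.
(* A majorant uniform in [t']: the base [s + (t' - s) x] stays above [s], its exponent is negative,
   and [x <= 1]. *)
pose G x := (H2 - H1) * s `^ (H2 - H1 - 1) * wgt x.
have G0 x : 0 <= G x by rewrite !mulr_ge0 ?wgt_ge0 ?powR_ge0// ltW.
have iG : mu.-integrable `]0, 1[ (EFin \o G).
  by apply: (integrableZl _ ((H2 - H1) * s `^ (H2 - H1 - 1)) integrable_wgt).
have c3 (t' x : R) : `]s, t + 1[%classic t' -> `]0, 1[%classic x -> `|partial1of2 f t' x| <= G x.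
  rewrite /= !in_itv /= => /andP[st' _] x01.
  have d := df t' x st' x01.
  rewrite /partial1of2 derive1E derive_val.
  have /andP[h3 h4] := itv_pt s t' x st' x01.
  have /andP[x0 x1] := x01.
  rewrite ger0_norm ?mulr_ge0 ?wgt_ge0 ?powR_ge0 ?(ltW a0) ?(ltW x0)//.
  rewrite /G mulrC ler_wpM2r ?wgt_ge0// -!mulrA ler_wpM2l ?(ltW a0)//.
  apply: (@le_trans _ _ ((s + (t' - s) * x) `^ (H2 - H1 - 1))).
    by rewrite ler_piMr ?powR_ge0// ltW.
  by rewrite (_ : H2 - H1 - 1 = - (1 - H2 + H1)); [apply: powR_anti; hlra|ring].
have m01 : measurable (`]0, 1[%classic : set (measurableTypeR R)) by exact: measurable_itv.
have dI := derivable_under_integral m01 tI c1 c2 G0 iG c3.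
have eI := differentiation_under_integral m01 tI c1 c2 G0 iG c3.
apply: DeriveDef; first exact: dI.
rewrite -derive1E [LHS]eI; apply: eq_Rintegral => x.
rewrite mem_setE in_itv /= => x01.
have d := df t x st x01.
by rewrite /partial1of2 derive1E derive_val.
Qed.

Lemma dKHE (t s : R) : 0 < s < t -> dKH H1 H2 t s = Dfun t s.
Proof.
move=> st0; have /andP[s0 st] := st0.
have d1 := is_derive_Ifun t s st0.
have pos : 0 < 1 * t + - s by rewrite mul1r subr_gt0.
have d2 := is_derive_powR_affine (H2 - H1) 1 (- s) t pos.
have d3 := is_deriveZ (betaH H2 * s `^ (2^-1 - H2)) (is_deriveM d2 d1).
rewrite /dKH derive1E.
apply: derive_val.
(* The factorization [KHE] requires [s < t'], which holds near [t]. *)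
apply: near_eq_is_derive (is_derive_eq d3 _).
  near=> t'.
  rewrite KHE.
    change (betaH H2 * s `^ (2^-1 - H2) * ((1 * t' - s) `^ (H2 - H1) * Ifun t' s) =
      betaH H2 * s `^ (2^-1 - H2) * ((t' - s) `^ (H2 - H1) * Ifun t' s)).
    by rewrite mul1r.
  by rewrite s0 /=; near: t'; exact: lt_nbhsr.
by rewrite /Dfun /GRing.scale /= mul1r; ring.
Unshelve. all: by end_near. Qed.

(** Each of the two terms of [Dfun] is at most [(t - s)^(H2 - H1 - 1) t^(H2 - H1) wint], because
    [H2 - H1 <= 1] and [t - s <= t]; this explains the factor 2. *)
Lemma dKH_bounds (t s : R) : 0 < s < t ->
  0 <= dKH H1 H2 t s <=
    2 * betaH H2 * wint * t `^ (H2 - H1) * (s `^ (2^-1 - H2) * (t - s) `^ (H2 - H1 - 1)).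
Proof.
move=> st0; have /andP[s0 st] := st0.
rewrite dKHE// /Dfun.
have [_ I0 I1] := Ifun_bounds t s st0.
have /andP[J0 J1] := Jfun_bounds t s st0.
have b0 : 0 <= betaH H2 by exact: sqrtr_ge0.
have a0 : 0 < H2 - H1 by hlra.
have W0 := wint_ge0.
have bs : 0 <= betaH H2 * s `^ (2^-1 - H2) by rewrite mulr_ge0 ?powR_ge0.
have p0 := powR_ge0 (t - s) (H2 - H1 - 1).
have q0 := powR_ge0 (t - s) (H2 - H1).
apply/andP; split.
  apply: mulr_ge0 => //; apply: addr_ge0; apply: mulr_ge0 => //.
  by apply: mulr_ge0 => //; exact: ltW.
have qt : (t - s) `^ (H2 - H1) <= t `^ (H2 - H1).
  by apply: ge0_ler_powR; rewrite ?nnegrE; hlra.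
set P := (t - s) `^ (H2 - H1 - 1) in p0 J1 *.
set q := (t - s) `^ (H2 - H1) in q0 qt *.
set T := t `^ (H2 - H1) in qt I1 *.
have T0 : 0 <= T by exact: powR_ge0.
have X1 : (H2 - H1) * P * Ifun t s <= P * (T * wint).
  apply: ler_pM => //; first by rewrite mulr_ge0// ltW.
  by rewrite ler_piMl//; hlra.
have X2 : q * Jfun t s <= T * (P * wint).
  apply: ler_pM => //; apply: (le_trans J1).
  by rewrite -mulrA ler_piMl ?mulr_ge0//; hlra.
have X3 : (H2 - H1) * P * Ifun t s + q * Jfun t s <= 2 * P * T * wint by hlra.
apply: (le_trans (ler_wpM2l bs X3)).
by rewrite le_eqVlt; apply/orP; left; apply/eqP; ring.
Qed.

Lemma measurable_Dfun : measurable_fun setT (fun z : R * R => Dfun z.1 z.2).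
Proof.
have mP (p : R) : measurable_fun setT
    (fun z : (R * R) * R => (z.1.2 + (z.1.1 - z.1.2) * z.2) `^ p).
  apply: measurable_fun_powR.
  have m12 : measurable_fun setT (fun z : (R * R) * R => z.1.2).
    exact: (measurableT_comp measurable_snd measurable_fst).
  have m11 : measurable_fun setT (fun z : (R * R) * R => z.1.1).
    exact: (measurableT_comp measurable_fst measurable_fst).
  apply: measurable_funD => //; apply: measurable_funM => //.
  exact: measurable_funB.
have mw : measurable_fun setT (fun z : (R * R) * R => wgt z.2).
  exact: (measurableT_comp (measurable_wgt setT) measurable_snd).
have mts (p : R) : measurable_fun setT (fun z : R * R => (z.1 - z.2) `^ p).
  by apply: measurable_fun_powR; exact: measurable_funB.
apply: measurable_funM.
  by apply: measurable_funM => //; exact: measurable_fun_powR.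
apply: measurable_funD; apply: measurable_funM.
- exact: measurable_funM.
- apply: (measurable_Rintegral2_in mu `]0, 1[ (fun z : (R * R) * R =>
    wgt z.2 * (z.1.2 + (z.1.1 - z.1.2) * z.2) `^ (H2 - H1))) => //.
  by apply: measurable_funM; [exact: mw|exact: mP].
- exact: mts.
- apply: (measurable_Rintegral2_in mu `]0, 1[ (fun z : (R * R) * R =>
    wgt z.2 * ((H2 - H1) * (z.1.2 + (z.1.1 - z.1.2) * z.2) `^ (H2 - H1 - 1) * z.2))) => //.
  apply: measurable_funM; first exact: mw.
  apply: measurable_funM; last exact: measurable_snd.
  by apply: measurable_funM; [exact: measurable_cst|exact: mP].
Qed.

End Kernel.

(** * The kernel k *)

Section GramKernel.
Context {R : realType}.
Notation mu := (@lebesgue_measure R).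
Variables H1 H2 gamma T : R.
Hypotheses (h1 : 2^-1 < H1) (h12 : H1 < H2) (h2 : H2 < 1).
Hypothesis h14 : 4^-1 < H2 - H1.
Hypotheses (gamma_gt0 : 0 < gamma) (T_gt0 : 0 < T).

Ltac hlra := (have := h1; have := h12; have := h2; have := h14; move=> ? ? ? ?; lra).

(** Extension by 0 lets every integral run over the whole line, and [s <= T] confines the operator
    to [(0, T]]. On the support [Dfun] equals [dKH]. *)
Definition mker (s v : measurableTypeR R) : R :=
  if (0 < v) && (v < s) && (s <= T)
  then gamma^-1 * s `^ (H1 - 2^-1) * Dfun H1 H2 s v else 0.

Lemma mker_dKH (s v : R) : 0 < v < s -> s <= T ->
  mker s v = gamma^-1 * s `^ (H1 - 2^-1) * dKH H1 H2 s v.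
Proof. by move=> vs sT; rewrite /mker vs sT dKHE. Qed.

Lemma mker_ge0 s v : 0 <= mker s v.
Proof.
rewrite /mker; case: ifP => // /andP[vs sT].
rewrite -dKHE//; have /andP[D0 _] := dKH_bounds _ _ h1 h12 h2 s v vs.
by rewrite !mulr_ge0 ?powR_ge0// invr_ge0 ltW.
Qed.

Lemma measurable_mker : measurable_fun setT (fun z : measurableTypeR R * measurableTypeR R => mker z.1 z.2).
Proof.
apply: measurable_fun_ifT.
- apply: measurable_and; first apply: measurable_and.
  + by apply: measurable_fun_ltr.
  + by apply: measurable_fun_ltr.
  + by apply: measurable_fun_ler.
- apply: measurable_funM; last exact: measurable_Dfun.
  by apply: measurable_funM => //; exact: measurable_fun_powR.
- exact: measurable_cst.
Qed.

(* [locked] keeps [rewrite mulr_ge0] from seeing the product. *)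
Definition cker : R := locked (gamma^-1 * (2 * betaH H2 * wint H1 H2)).

Lemma cker_ge0 : 0 <= cker.
Proof.
rewrite /cker -lock; have b0 : 0 <= betaH H2 by exact: sqrtr_ge0.
have w0 := wint_ge0 H1 H2.
have g0 : 0 <= gamma^-1 by rewrite invr_ge0 ltW.
by apply: mulr_ge0 => //; apply: mulr_ge0 => //; exact: mulr_ge0.
Qed.

Lemma mker_le (s v : R) : 0 < v < s -> s <= T ->
  mker s v <= cker * s `^ (H2 - 2^-1) * (v `^ (2^-1 - H2) * (s - v) `^ (H2 - H1 - 1)).
Proof.
move=> vs sT; rewrite mker_dKH//.
have /andP[v0 vs'] := vs; have s0 := lt_trans v0 vs'.
have /andP[_ D1] := dKH_bounds _ _ h1 h12 h2 s v vs.
have g0 : 0 <= gamma^-1 * s `^ (H1 - 2^-1).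
  by rewrite mulr_ge0 ?powR_ge0// invr_ge0 ltW.
apply: (le_trans (ler_wpM2l g0 D1)).
have -> : s `^ (H2 - 2^-1) = s `^ (H1 - 2^-1) * s `^ (H2 - H1).
  by rewrite -powRD ?(gt_eqF s0) ?implybT//; congr (_ `^ _); ring.
by rewrite /cker -lock le_eqVlt; apply/orP; left; apply/eqP; ring.
Qed.

Lemma mker_ge (s v : R) : ~~ (0 < v < s) -> mker s v = 0.
Proof. by rewrite /mker => /negbTE ->. Qed.

Lemma mker_out (s v : R) : ~~ (0 < s <= T) -> mker s v = 0.
Proof.
rewrite /mker; case: ifP => // /andP[/andP[v0 vs] sT].
by rewrite (lt_trans v0 vs) sT.
Qed.

Opaque mker.

(** * Bounds on the Gram kernel off the diagonal *)

Lemma gram_out (u s : R) : ~~ (0 < s <= T) -> gram mu mker u s = 0%E.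
Proof.
by move=> sT; apply: integral0_eq => v _; rewrite mker_out// mul0r.
Qed.

(** Let [a = H2 - H1]. Of the singular exponent [1 - a], a share [b] goes to the inner integral,
    which needs [1 - a + b < 1]; the rest must be square integrable, so [2 (1 - a - b) < 1]. Such a
    [b] exists exactly when [a > 1/4], and [b = 1/4] then always works. *)
Definition theta : R := 3 / 4 - (H2 - H1).

Definition cbeta (p q : R) : R := 2 `^ q / (1 - p) + 2 `^ p / (1 - q).

Definition cgram : R := locked (cker ^+ 2 * T `^ (H2 - 2^-1) *
  T `^ (H2 - H1 - 4^-1) * cbeta (2 * H2 - 1) (5 / 4 - (H2 - H1))).

Lemma cbeta_ge0 p q : p < 1 -> q < 1 -> 0 <= cbeta p q.
Proof. by move=> p1 q1; rewrite addr_ge0// divr_ge0 ?powR_ge0// subr_ge0 ltW. Qed.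

Lemma cgram_ge0 : 0 <= cgram.
Proof.
have c0 : 0 <= cbeta (2 * H2 - 1) (5 / 4 - (H2 - H1)) by apply: cbeta_ge0; hlra.
by rewrite /cgram -lock !mulr_ge0 ?powR_ge0 ?cker_ge0.
Qed.

(* The singularity [(u - v)^-al] with [al = 1 - (H2 - H1)] is split as
   [(u - v)^-theta (u - v)^-(1/4) <= (u - s)^-theta (s - v)^-(1/4)]. *)
Lemma gram_le (s u : R) : 0 < s < u -> u <= T ->
  (gram mu mker u s <= (cgram * (s `^ (2^-1 - H2) * (u - s) `^ (- theta)))%:E)%E.
Proof.
move=> /andP[s0 su] uT.
have sT : s <= T by rewrite (le_trans (ltW su)).
have u0 : 0 < u by exact: lt_trans su.
pose K := cker ^+ 2 * s `^ (H2 - 2^-1) * u `^ (H2 - 2^-1) * (u - s) `^ (- theta).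
have K0 : 0 <= K by rewrite /K !mulr_ge0 ?powR_ge0 ?cker_ge0.
(* [p] collects the two factors [v^(1/2 - H2)], and [q = 1 - (H2 - H1) + 1/4] collects the
   singularities at [v = s]. *)
pose p := 2 * H2 - 1; pose q := 5 / 4 - (H2 - H1).
have p01 : 0 <= p < 1 by rewrite /p; apply/andP; split; hlra.
have q01 : 0 <= q < 1 by rewrite /q; apply/andP; split; hlra.
pose Q v := (v - 0) `^ (- p) * (s - v) `^ (- q).
have mQ D : measurable_fun D Q.
  apply: measurable_funTS; apply: measurable_funM; apply: measurable_fun_powR;
  exact: measurable_funB.
have mm := measurable_mker.
have mmm : measurable_fun setT (fun v => (mker s v * mker u v)%:E).
  by apply/measurable_EFinP/measurable_funM; exact: measurable_m2.
rewrite /gram.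
rewrite (_ : (\int[mu]_v _)%E = (\int[mu]_(v in `]0%R, s[) (mker s v * mker u v)%:E)%E); last first.
  rewrite [RHS]integral_mkcond; apply: eq_integral => v _.
  rewrite patchE mem_setE in_itv /=; case: ifPn => // vs.
  by rewrite (mker_ge s v vs) mul0r.
apply: (@le_trans _ _ (\int[mu]_(v in `]0%R, s[) (K%:E * (Q v)%:E))%E).
  apply: ge0_le_integral => //.
  - by move=> v _; rewrite lee_fin mulr_ge0 ?mker_ge0.
  - exact: measurable_funTS.
  - by apply: emeasurable_funM => //; apply/measurable_EFinP; exact: mQ.
  move=> v; rewrite /= in_itv /= => vs; have /andP[v0 vs'] := vs.
  have vu : 0 < v < u by rewrite v0 (lt_trans vs').
  rewrite -EFinM lee_fin.
  apply: (le_trans (ler_pM (mker_ge0 _ _) (mker_ge0 _ _) (mker_le _ _ vs sT) (mker_le _ _ vu uT))).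
  have E1 : (u - v) `^ (H2 - H1 - 1) = (u - v) `^ (- theta) * (u - v) `^ (- 4^-1).
    rewrite -powRD; first by congr (_ `^ _); rewrite /theta; field.
    by rewrite (subr_eq0 u v) (gt_eqF (lt_trans vs' su)) implybT.
  have E2 : (u - v) `^ (- theta) <= (u - s) `^ (- theta).
    by apply: powR_anti; rewrite ?subr_gt0 ?lerD2l ?lerN2 ?(ltW vs')// /theta; hlra.
  have E3 : (u - v) `^ (- 4^-1) <= (s - v) `^ (- 4^-1).
    by apply: powR_anti; rewrite ?subr_gt0 ?lerD2r ?(ltW su)//.
  have E4 : (u - v) `^ (H2 - H1 - 1) <= (u - s) `^ (- theta) * (s - v) `^ (- 4^-1).
    by rewrite E1; apply: ler_pM; rewrite ?powR_ge0.
  have E5 : (v - 0) `^ (- p) = v `^ (2^-1 - H2) * v `^ (2^-1 - H2).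
    by rewrite subr0 -powRD ?(gt_eqF v0) ?implybT//; congr (_ `^ _); rewrite /p; field.
  have E6 : (s - v) `^ (- q) = (s - v) `^ (H2 - H1 - 1) * (s - v) `^ (- 4^-1).
    rewrite -powRD; first by congr (_ `^ _); rewrite /q; field.
    by rewrite (subr_eq0 s v) (gt_eqF vs') implybT.
  rewrite /Q E5 E6 /K.
  set c := cker; set S := s `^ _; set U := u `^ _; set V := v `^ _.
  set A := (s - v) `^ (H2 - H1 - 1).
  apply: (@le_trans _ _ (c * S * (V * A) * (c * U * (V * ((u - s) `^ (- theta) * (s - v) `^ (- 4^-1)))))).
    apply: ler_wpM2l; first by rewrite !mulr_ge0 ?powR_ge0 ?cker_ge0.
    apply: ler_wpM2l; first by rewrite mulr_ge0 ?powR_ge0 ?cker_ge0.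
    by apply: ler_wpM2l; rewrite ?powR_ge0.
  by rewrite le_eqVlt; apply/orP; left; apply/eqP; ring.
rewrite ge0_integralZl//; last 2 first.
- by apply/measurable_EFinP; exact: mQ.
- by move=> v _; rewrite lee_fin mulr_ge0 ?powR_ge0.
apply: (le_trans (lee_wpmul2l _ (integral_beta_le p q 0 s p01 q01 s0))); first by rewrite lee_fin.
rewrite -EFinM lee_fin subr0 -/(cbeta p q).
(* Beyond the desired [s^(1/2 - H2)] there is a surplus power of positive exponent, which is bounded
   by the same power of [T]. *)
have E1 : s `^ (H2 - 2^-1) * s `^ (1 - p - q) = s `^ (2^-1 - H2) * s `^ (H2 - H1 - 4^-1).
  by rewrite -!powRD ?(gt_eqF s0) ?implybT//; congr (_ `^ _); rewrite /p /q; field.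
have E2 : s `^ (H2 - H1 - 4^-1) <= T `^ (H2 - H1 - 4^-1).
  by apply: ge0_ler_powR; rewrite ?nnegrE ?(ltW s0) ?(ltW T_gt0)//; hlra.
have E3 : u `^ (H2 - 2^-1) <= T `^ (H2 - 2^-1).
  by apply: ge0_ler_powR; rewrite ?nnegrE ?(ltW u0) ?(ltW T_gt0)//; hlra.
have cb0 : 0 <= cbeta p q by apply: cbeta_ge0; [case/andP: p01|case/andP: q01].
rewrite (_ : K * _ = cker ^+ 2 * cbeta p q * (u - s) `^ (- theta) * s `^ (2^-1 - H2) *
    (u `^ (H2 - 2^-1) * s `^ (H2 - H1 - 4^-1))); last first.
  rewrite [RHS](_ : _ = cker ^+ 2 * cbeta p q * (u - s) `^ (- theta) * u `^ (H2 - 2^-1) *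
    (s `^ (2^-1 - H2) * s `^ (H2 - H1 - 4^-1))); last by ring.
  by rewrite -E1 /K; ring.
apply: (@le_trans _ _ (cker ^+ 2 * cbeta p q * (u - s) `^ (- theta) * s `^ (2^-1 - H2) *
    (T `^ (H2 - 2^-1) * T `^ (H2 - H1 - 4^-1)))).
  apply: ler_wpM2l; first by rewrite !mulr_ge0 ?powR_ge0 ?cker_ge0.
  by apply: ler_pM; rewrite ?powR_ge0.
by rewrite /cgram -lock le_eqVlt; apply/orP; left; apply/eqP; rewrite -/p -/q; ring.
Qed.

(** The bound [gram_le] on both sides of the diagonal, by symmetry. The points [s = u] and [s = T]
    are left out as a null set, so that the pieces are open intervals. *)
Definition qker (u s : R) : R :=
  if 0 < s < u then cgram * (s `^ (2^-1 - H2) * (u - s) `^ (- theta)) else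
  if u < s < T then cgram * (u `^ (2^-1 - H2) * (s - u) `^ (- theta)) else 0.

Lemma qker_ge0 u s : 0 <= qker u s.
Proof.
rewrite /qker; case: ifP => _; [|case: ifP => _ //];
  by apply: mulr_ge0; [exact: cgram_ge0|rewrite mulr_ge0 ?powR_ge0].
Qed.

Lemma gram_le_qker (u s : R) : 0 < u <= T -> s != u -> s != T ->
  (gram mu mker u s <= (qker u s)%:E)%E.
Proof.
move=> /andP[u0 uT] su sT; rewrite /qker.
case: ifPn => [us|]; first exact: gram_le.
move=> nsu; case: ifPn => [/andP[us sT']|nus].
  by rewrite gramC; apply: gram_le; rewrite ?u0// ltW.
rewrite gram_out//; apply/negP => /andP[s0 sT'].
move: nsu nus; rewrite s0 /= [s < T]lt_neqAle sT sT' andbT -leNgt => us.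
by rewrite lt_neqAle eq_sym su us.
Qed.

Lemma measurable_qker u : measurable_fun setT (qker u).
Proof.
have mp (p x : R) : measurable_fun setT (fun s : R => (s - x) `^ p).
  by apply: measurable_fun_powR; exact: measurable_funB.
apply: measurable_fun_ifT.
- by apply: measurable_and; apply: measurable_fun_ltr.
- apply: measurable_funM => //; apply: measurable_funM; apply: measurable_fun_powR => //.
  exact: measurable_funB.
- apply: measurable_fun_ifT => //.
  + by apply: measurable_and; apply: measurable_fun_ltr.
  + apply: measurable_funM => //; apply: measurable_funM => //; exact: mp.
Qed.

(** The final [+ 1] makes the constant positive, as [integral_mul_le] demands, where [cgram] is only
    known to be nonnegative. *)
Definition cM2 : R := cgram ^+ 2 * T `^ (1 - 2 * theta) *
  (cbeta (2 * H2 - 1) (2 * theta) + (1 - 2 * theta)^-1) + 1.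

Lemma cM2_gt0 : 0 < cM2.
Proof.
rewrite /cM2 ltr_wpDl//; apply: mulr_ge0; first by rewrite mulr_ge0 ?sqr_ge0 ?powR_ge0.
apply: addr_ge0.
  by apply: cbeta_ge0; rewrite /theta; hlra.
by rewrite invr_ge0 /theta; hlra.
Qed.

(** Below the diagonal the Beta bound gives [u^(1 - p - q)]; above it [u^(- p)] is constant in [s]
    and the rest integrates to at most a multiple of [T^(1 - q)]. Both pieces are thus controlled by
    [u^(- p) T^(1 - q)]. *)
Lemma sqint_qker u : 0 < u <= T ->
  (sqint mu (qker u) <= (cM2 * u `^ (1 - 2 * H2))%:E)%E.
Proof.
move=> /andP[u0 uT].
pose p := 2 * H2 - 1; pose q := 2 * theta.
have p01 : 0 <= p < 1 by rewrite /p; apply/andP; split; hlra.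
have q01 : 0 <= q < 1 by rewrite /q /theta; apply/andP; split; hlra.
have /andP[q0 q1] := q01; have /andP[p0 p1] := p01.
pose A s := (s - 0) `^ (- p) * (u - s) `^ (- q).
pose B s := (s - u) `^ (- q).
have mA : measurable_fun setT A.
  by apply: measurable_funM; apply: measurable_fun_powR; exact: measurable_funB.
have mB : measurable_fun setT B by apply: measurable_fun_powR; exact: measurable_funB.
have sq (x r : R) : (x `^ r) ^+ 2 = x `^ (2 * r).
  by rewrite mulrC powRrM powR_mulrn ?powR_ge0.
have pt0 : (point : \bar R) = 0%E by [].
pose k1 := cgram ^+ 2; pose k2 := cgram ^+ 2 * u `^ (- p).
have k10 : 0 <= k1 by exact: sqr_ge0.
have k20 : 0 <= k2 by rewrite mulr_ge0 ?powR_ge0.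
have -> : sqint mu (qker u) = (\int[mu]_(s in `]0%R, u[) (k1%:E * (A s)%:E) +
    \int[mu]_(s in `]u, T[) (k2%:E * (B s)%:E))%E.
  rewrite [X in (X + _)%E]integral_mkcond [X in (_ + X)%E]integral_mkcond -ge0_integralD//; last 4 first.
  - move=> x _; rewrite patchE; case: ifP => // _; rewrite -EFinM lee_fin.
    by apply: mulr_ge0 => //; rewrite mulr_ge0 ?powR_ge0.
  - apply/(measurable_restrictT _ _).1 => //; apply/measurable_EFinP.
    by apply: measurable_funTS; exact: measurable_funM.
  - move=> x _; rewrite patchE; case: ifP => // _; rewrite -EFinM lee_fin.
    by apply: mulr_ge0 => //; exact: powR_ge0.
  - apply/(measurable_restrictT _ _).1 => //; apply/measurable_EFinP.
    by apply: measurable_funTS; exact: measurable_funM.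
  apply: eq_integral => s _; rewrite !patchE !mem_setE !in_itv /= /qker.
  case: ifPn => [/andP[s0 su]|_].
    rewrite (lt_gtF su) /= pt0 adde0 -EFinM; congr EFin.
    rewrite !exprMn !sq /A /k1 subr0 /p /q.
    by congr (_ * (_ `^ _ * _ `^ _)); field.
  rewrite pt0; case: ifPn => [_|_]; last by rewrite expr0n adde0.
  rewrite add0e -EFinM; congr EFin.
  rewrite !exprMn !sq /B /k2 /p /q mulrA.
  by congr (_ * _ `^ _ * _ `^ _); field.
rewrite !ge0_integralZl//; last 4 first.
- by apply/measurable_EFinP; exact: measurable_funTS.
- by move=> s _; rewrite lee_fin powR_ge0.
- by apply/measurable_EFinP; exact: measurable_funTS.
- by move=> s _; rewrite lee_fin mulr_ge0 ?powR_ge0.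
have uq : u `^ (1 - q) <= T `^ (1 - q).
  by apply: ge0_ler_powR; rewrite ?nnegrE ?(ltW u0) ?(ltW T_gt0)//; lra.
have I1 : (k1%:E * \int[mu]_(s in `]0%R, u[) (A s)%:E <=
    (k1 * (cbeta p q * (u `^ (- p) * T `^ (1 - q))))%:E)%E.
  rewrite [leRHS]EFinM lee_wpmul2l ?lee_fin//.
  apply: (le_trans (integral_beta_le p q 0 u p01 q01 u0)).
  rewrite lee_fin subr0 ler_wpM2l ?cbeta_ge0//.
  rewrite (_ : 1 - p - q = - p + (1 - q)); last by ring.
  by rewrite powRD ?(gt_eqF u0) ?implybT// ler_wpM2l ?powR_ge0.
have I2 : (k2%:E * \int[mu]_(s in `]u, T[) (B s)%:E <= (k2 * (T `^ (1 - q) / (1 - q)))%:E)%E.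
  rewrite [leRHS]EFinM lee_wpmul2l ?lee_fin//.
  have [uT'|Tu] := ltP u T; last first.
    by rewrite set_itv_ge ?bnd_simp -?leNgt// integral_set0 lee_fin divr_ge0 ?powR_ge0// subr_ge0 ltW.
  apply: (le_trans (integral_powR_left q u T q1 uT')).
  rewrite lee_fin ler_wpM2r ?invr_ge0 ?subr_ge0 ?(ltW q1)//.
  by apply: ge0_ler_powR; rewrite ?nnegrE; lra.
apply: (le_trans (leeD I1 I2)).
rewrite -EFinD lee_fin /cM2 -/p -/q (_ : 1 - 2 * H2 = - p); last by rewrite /p; ring.
rewrite -subr_ge0.
rewrite (_ : _ - _ = u `^ (- p)) ?powR_ge0//.
by rewrite /k1 /k2; field; rewrite gt_eqF// subr_gt0.
Qed.

(** * The hypotheses on the Gram operator *)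

Definition cut (c r : R) (u : measurableTypeR R) : R :=
  if 0 < u <= T then c * u `^ r else 0.

Definition Mker := cut (Num.sqrt cM2) (2^-1 - H2).

Definition fker := cut 1 (2^-1 - H1).

Lemma measurable_cut (c r : R) : measurable_fun setT (cut c r).
Proof.
apply: measurable_fun_ifT => //.
- by apply: measurable_and; [apply: measurable_fun_ltr|apply: measurable_fun_ler].
- by apply: measurable_funM => //; exact: measurable_fun_powR.
Qed.

(** Square integrability at 0 asks for [2 r > -1]. The exponents [1/2 - H2] of [Mker] and [1/2 - H1]
    of [fker] qualify since both indices are below 1. *)
Lemma sqint_cut (c r : R) : - 2^-1 < r -> exists N, 0 < N /\
  (sqint mu (cut c r) <= N%:E)%E.
Proof.
move=> r0; exists (c ^+ 2 * (T `^ (1 - (- (2 * r))) / (1 - (- (2 * r)))) + 1); split.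
  by rewrite ltr_wpDl// mulr_ge0 ?sqr_ge0// divr_ge0 ?powR_ge0//; lra.
have r1 : - (2 * r) < 1 by lra.
have -> : sqint mu (cut c r) =
    (\int[mu]_(u in `]0%R, T]) ((c ^+ 2)%:E * (u `^ (- (- (2 * r))))%:E))%E.
  rewrite [RHS]integral_mkcond; apply: eq_integral => u _.
  rewrite patchE mem_setE in_itv /= /cut; case: ifPn => _; last by rewrite expr0n.
  by rewrite -EFinM exprMn opprK mulrC [2 * r]mulrC powRrM powR_mulrn ?powR_ge0// mulrC.
rewrite -integral_itv_bndo_bndc; last first.
  apply: measurable_funTS; apply: emeasurable_funM => //; apply/measurable_EFinP.
  exact: measurable_fun_powR.
rewrite ge0_integralZl//; last 3 first.
- by apply/measurable_EFinP; exact: measurable_fun_powR.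
- by move=> u _; rewrite lee_fin powR_ge0.
- by rewrite lee_fin sqr_ge0.
apply: (@le_trans _ _ ((c ^+ 2)%:E * (T `^ (1 - (- (2 * r))) / (1 - (- (2 * r))))%:E)%E).
  by apply: lee_wpmul2l; [rewrite lee_fin sqr_ge0|exact: integral_powR].
by rewrite -EFinM lee_fin lerDl.
Qed.

Lemma ae_neq2 (x y : R) (P : R -> Prop) :
  (forall s, s != x -> s != y -> P s) -> {ae mu, forall s, P s}.
Proof.
move=> xyP; exists [set x; y]; split.
- by apply: measurableU; exact: measurable_set1.
- by apply: countable_lebesgue_measure0; exact/finite_set_countable/finite_set2.
move=> s /= nP; apply: contrapT => /not_orP[sx sy]; apply: nP; apply: xyP.
  by apply/eqP.
by apply/eqP.
Qed.

Lemma gram_fin_ae (u : measurableTypeR R) : {ae mu, forall s, (gram mu mker u s < +oo)%E}.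
Proof.
have [u0|u0] := boolP (0 < u <= T).
  apply: (ae_neq2 u T) => s su sT.
  exact: le_lt_trans (gram_le_qker _ _ u0 su sT) (ltry _).
by apply: nearW => s; rewrite gramC gram_out// ltry.
Qed.

(** Almost everywhere [gram u] is below [qker u], whose L^2 norm is at most [Mker u], and
    Cauchy-Schwarz applies. For [u] outside [(0, T]] the Gram kernel vanishes. *)
Lemma gram_bound_Mker (u : measurableTypeR R) (g : measurableTypeR R -> R) (B : R) :
  measurable_fun setT g -> 0 < B -> (sqint mu g <= (B ^+ 2)%:E)%E ->
  (\int[mu]_s (`|g s|%:E * gram mu mker u s) <= (B * Mker u)%:E)%E.
Proof.
move=> mg B0 gB; rewrite /Mker /cut; case: ifPn => [uT|nuT]; last first.
  rewrite mulr0 (_ : (\int[mu]_s _)%E = 0%E)//.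
  by apply: integral0_eq => s _; rewrite gramC gram_out// mule0.
have /andP[u0 uT'] := uT.
have mgr := measurable_gram2 mu mker mker_ge0 measurable_mker u.
have mq := measurable_qker u.
apply: (@le_trans _ _ (\int[mu]_s (`|g s| * `|qker u s|)%:E)%E).
  apply: ae_ge0_le_integral => //.
  - by move=> s _; rewrite mule_ge0// ?lee_fin// gram_ge0// => *; exact: mker_ge0.
  - by apply: emeasurable_funM => //; apply/measurable_EFinP; exact: measurableT_comp.
  - by apply/measurable_EFinP; apply: measurable_funM; exact: measurableT_comp.
  apply: (ae_neq2 u T) => s su sT _.
  rewrite EFinM lee_wpmul2l ?lee_fin// ger0_norm ?qker_ge0//.
  exact: gram_le_qker.
apply: integral_mul_le => //.
  by rewrite mulr_gt0 ?powR_gt0// sqrtr_gt0 cM2_gt0.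
apply: (le_trans (sqint_qker _ uT)).
rewrite lee_fin exprMn sqr_sqrtr ?(ltW cM2_gt0)//.
rewrite -[X in _ <= _ * X]powR_mulrn ?powR_ge0// -powRrM.
by rewrite le_eqVlt; apply/orP; left; apply/eqP; congr (_ * _ `^ _); field.
Qed.

(** * Transfer to the original equation *)

Lemma gramr_kH (u s : R) : 0 < u <= T -> 0 < s <= T ->
  gramr mu mker u s = gamma^-1 ^+ 2 * (s `^ (H1 - 2^-1) * u `^ (H1 - 2^-1)) * kH H1 H2 s u.
Proof.
move=> /andP[u0 uT] /andP[s0 sT].
set c := gamma^-1 ^+ 2 * _.
have c0 : 0 < c by rewrite !mulr_gt0 ?powR_gt0 ?exprn_gt0 ?invr_gt0.
(* Scaling by [c > 0] commutes with [fine] at infinity too, so the identity also holds where the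
   integral diverges: both sides are then 0. *)
have fineZ (x : \bar R) : fine (c%:E * x)%E = c * fine x.
  case: x => [r| |] //=; first by rewrite gt0_muley ?lte_fin//= mulr0.
  by rewrite gt0_muleNy ?lte_fin//= mulr0.
rewrite /kH /Rintegral -fineZ /gramr /gram; congr fine.
have sE v : 0 < v < Order.min s u -> 0 < v < s /\ 0 < v < u.
  by rewrite lt_min => /andP[v0 /andP[vs vu]]; rewrite v0 vs vu.
rewrite -ge0_integralZl//; last 3 first.
- apply: (@eq_measurable_fun _ _ _ _ _ (fun v => (Dfun H1 H2 s v * Dfun H1 H2 u v)%:E)).
    move=> v; rewrite mem_setE in_itv /= => /sE[vs vu].
    by rewrite !dKHE.
  apply: measurable_funTS; apply/measurable_EFinP; apply: measurable_funM.
    apply: (measurableT_comp (measurable_Dfun H1 H2) (g := fun v : R => (s, v))).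
    exact: measurable_fun_pair.
  apply: (measurableT_comp (measurable_Dfun H1 H2) (g := fun v : R => (u, v))).
  exact: measurable_fun_pair.
- move=> v; rewrite /= in_itv /= => /sE[vs vu].
  have /andP[D0 _] := dKH_bounds _ _ h1 h12 h2 s v vs.
  have /andP[D1 _] := dKH_bounds _ _ h1 h12 h2 u v vu.
  by rewrite lee_fin; exact: mulr_ge0 D0 D1.
- by rewrite lee_fin ltW.
rewrite [RHS]integral_mkcond; apply: eq_integral => v _.
rewrite patchE mem_setE in_itv /=; case: ifPn => [/sE[vs vu]|].
  rewrite (mker_dKH s v vs sT) (mker_dKH u v vu uT) -EFinM; congr EFin; rewrite /c.
  by move: (dKH H1 H2 s v) (dKH H1 H2 u v) => x y; ring.
rewrite lt_min => nv; have [vs|vs] := boolP (0 < v < s); last by rewrite (mker_ge s v vs) mul0r.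
rewrite (mker_ge u v) ?mulr0//; apply/negP => /andP[v0 vu].
by move: nv; have /andP[_ vs'] := vs; rewrite v0 vs' vu.
Qed.

Definition gfun (h : R -> R) (s : measurableTypeR R) : R :=
  if 0 < s <= T then h s * s `^ (2^-1 - H1) else 0.

Lemma gfun_admissible h : admissible H1 T h ->
  measurable_fun setT (gfun h) /\ (sqint mu (gfun h) < +oo)%E.
Proof.
move=> [mh hi]; split.
  rewrite (_ : gfun h = (fun s => h s * s `^ (2^-1 - H1)) \_ `]0, T]); last first.
    by rewrite funeqE => s; rewrite patchE mem_setE in_itv /= /gfun.
  apply/(measurable_restrictT _ _).1 => //.
  by apply: measurable_funM => //; exact: measurable_fun_powR.
apply: le_lt_trans hi; rewrite le_eqVlt; apply/orP; left; apply/eqP.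
rewrite /oc0 [RHS]integral_mkcond; apply: eq_integral => s _.
by rewrite patchE mem_setE in_itv /= /gfun; case: ifP => //; rewrite expr0n.
Qed.

Lemma gramop_out (g : measurableTypeR R -> R) (u : R) : ~~ (0 < u <= T) -> gramop mu mker g u = 0.
Proof.
move=> uT; rewrite /gramop /Rintegral integral0_eq// => s _.
by rewrite /gramr gramC gram_out// mulr0.
Qed.

Lemma powR_cancel (s r : R) : 0 < s -> s `^ r * s `^ (- r) = 1.
Proof. by move=> s0; rewrite -powRD ?(gt_eqF s0) ?implybT// subrr powRr0. Qed.

(** The weights in [gramr_kH] cancel against those of [gfun]. Integrability makes the extended-real
    integral in [solves_eq] finite, so the equation can be read in [R]. *)
Lemma integral_kH (h : R -> R) (u : R) : 0 < u <= T ->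
  measurable_fun setT (gfun h) -> (sqint mu (gfun h) < +oo)%E ->
  (\int[mu]_(s in (oc0 T)) (h s * kH H1 H2 s u)%:E =
   (gamma ^+ 2 * u `^ (2^-1 - H1) * gramop mu mker (gfun h) u)%:E)%E.
Proof.
move=> uT mg gi; have /andP[u0 _] := uT.
have [N [N0 MN]] : exists N, 0 < N /\ (sqint mu Mker <= N%:E)%E.
  by apply: sqint_cut; hlra.
have ig : mu.-integrable setT (fun s => (gfun h s * gramr mu mker u s)%:E).
  exact: (integrable_gramop mu mker mker_ge0 measurable_mker Mker gram_bound_Mker (gfun h) u mg gi).
rewrite EFinM /gramop /Rintegral fineK; last exact: integrable_fin_num ig.
rewrite -integralZl// /oc0 [LHS]integral_mkcond; apply: eq_integral => s _.
rewrite patchE mem_setE in_itv /= /gfun; case: ifPn => [sT|_]; last by rewrite mul0r mule0.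
have /andP[s0 _] := sT.
rewrite gramr_kH// -EFinM; congr EFin.
have e1 : s `^ (2^-1 - H1) * s `^ (H1 - 2^-1) = 1.
  by rewrite -[H1 - 2^-1]opprB powR_cancel.
have e2 : u `^ (2^-1 - H1) * u `^ (H1 - 2^-1) = 1.
  by rewrite -[H1 - 2^-1]opprB powR_cancel.
have e3 : gamma ^+ 2 * gamma^-1 ^+ 2 = 1.
  by rewrite -exprMn divff ?expr1n// gt_eqF.
rewrite [RHS](_ : _ = (gamma ^+ 2 * gamma^-1 ^+ 2) *
  (s `^ (2^-1 - H1) * s `^ (H1 - 2^-1)) * (u `^ (2^-1 - H1) * u `^ (H1 - 2^-1)) *
  (h s * kH H1 H2 s u)); last by ring.
by rewrite e1 e2 e3 !mul1r.
Qed.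

Lemma solves_eqP (h : R -> R) :
  measurable_fun setT (gfun h) -> (sqint mu (gfun h) < +oo)%E ->
  solves_eq H1 H2 gamma T h <->
  forall u, fker u = gfun h u + gramop mu mker (gfun h) u.
Proof.
move=> mg gi.
have pE (u : R) : 0 < u -> u `^ (1 - 2 * H1) = u `^ (2^-1 - H1) * u `^ (2^-1 - H1).
  by move=> u0; rewrite -powRD ?(gt_eqF u0) ?implybT//; congr (_ `^ _); field.
have gE (u : R) : 0 < u <= T -> gfun h u = h u * u `^ (2^-1 - H1) by rewrite /gfun => ->.
have fE (u : R) : 0 < u <= T -> fker u = u `^ (2^-1 - H1).
  by rewrite /fker /cut => ->; rewrite mul1r.
split=> [sol u|sol u uT].
  have [uT|uT] := boolP (0 < u <= T); last first.
    by rewrite gramop_out// /fker /cut /gfun (negbTE uT) addr0.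
  have := sol u uT; have /andP[u0 _] := uT.
  rewrite integral_kH// -EFinD => -[].
  rewrite pE// (fE u uT) (gE u uT) => E.
  (* The original equation at [u] is this nonzero factor times the transformed one. *)
  have k0 : gamma ^+ 2 * u `^ (2^-1 - H1) != 0.
    by rewrite gt_eqF// mulr_gt0 ?powR_gt0// exprn_gt0.
  apply: (mulfI k0).
  by move: E; set K := gramop _ _ _ _; set U := u `^ _; lra.
have /andP[u0 _] := uT.
rewrite integral_kH// -EFinD; congr EFin.
have := sol u; rewrite (fE u uT) (gE u uT) pE//.
set K := gramop _ _ _ _; set U := u `^ _ => E.
by have := congr1 (fun z => gamma ^+ 2 * U * z) E; lra.
Qed.

Lemma solves_eq_wellposed :
  (exists h : R -> R, admissible H1 T h /\ solves_eq H1 H2 gamma T h) /\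
  (forall h h' : R -> R,
     admissible H1 T h -> solves_eq H1 H2 gamma T h ->
     admissible H1 T h' -> solves_eq H1 H2 gamma T h' ->
     forall u, 0 < u <= T -> h u = h' u).
Proof.
have [N [N0 MN]] : exists N, 0 < N /\ (sqint mu Mker <= N%:E)%E.
  by apply: sqint_cut; hlra.
have [Nf [Nf0 fN]] : exists N, 0 < N /\ (sqint mu fker <= N%:E)%E.
  by apply: sqint_cut; hlra.
have fi : (sqint mu fker < +oo)%E by exact: le_lt_trans fN (ltry _).
have mM : measurable_fun setT Mker by exact: measurable_cut.
have mf : measurable_fun setT fker by exact: measurable_cut.
have M0 u : 0 <= Mker u.
  by rewrite /Mker /cut; case: ifP => // _; rewrite mulr_ge0 ?powR_ge0 ?sqrtr_ge0.
split.
  have [g [mg gi gE]] := gramop_surj mu mker mker_ge0 measurable_mker Mker N mM M0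
    N0 MN gram_fin_ae gram_bound_Mker fker mf fi.
  pose h (s : R) := g s * s `^ (H1 - 2^-1).
  have gh : gfun h = g.
    rewrite funeqE => s; rewrite /gfun /h; case: ifPn => [/andP[s0 _]|sT].
      by rewrite -mulrA -[2^-1 - H1]opprB powR_cancel// mulr1.
    (* Outside [(0, T]] both [fker] and [gramop g] vanish, so the equation itself forces [g] to be 0
       there. *)
    by have := gE s; rewrite gramop_out// addr0 /fker /cut (negbTE sT).
  exists h; split; last by apply/solves_eqP; rewrite gh.
  split.
    apply: measurable_funTS; apply: measurable_funM => //; exact: measurable_fun_powR.
  apply: le_lt_trans gi; rewrite /oc0 integral_mkcond.
  rewrite le_eqVlt; apply/orP; left; apply/eqP; apply: eq_integral => s _.
  rewrite patchE mem_setE in_itv /= -[in RHS]gh /gfun.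
  by case: ifP => //; rewrite expr0n.
move=> h h' ah sh ah' sh' u uT.
have [mg gi] := gfun_admissible _ ah.
have [mg' gi'] := gfun_admissible _ ah'.
have /(solves_eqP _ mg gi) E := sh.
have /(solves_eqP _ mg' gi') E' := sh'.
have gg : gfun h = gfun h'.
  apply: (gramop_inj mu mker mker_ge0 measurable_mker Mker N mM M0
    MN gram_fin_ae gram_bound_Mker) => // x.
  by rewrite -E -E'.
have : gfun h u = gfun h' u by rewrite gg.
rewrite /gfun uT; have /andP[u0 _] := uT.
by apply: mulIf; rewrite gt_eqF// powR_gt0.
Qed.

End GramKernel.

Theorem theorem2p3 (R : realType) (H1 H2 gamma : R) :
  2^-1 < H1 -> H1 < H2 -> H2 < 1 -> 4^-1 < H2 - H1 -> 0 < gamma ->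
  exists T : nat -> R,
    (T n @[n --> \oo] --> +oo) /\
    forall n, 0 < T n /\
      (exists h : R -> R, admissible H1 (T n) h /\ solves_eq H1 H2 gamma (T n) h) /\
      (forall h1 h2 : R -> R,
         admissible H1 (T n) h1 -> solves_eq H1 H2 gamma (T n) h1 ->
         admissible H1 (T n) h2 -> solves_eq H1 H2 gamma (T n) h2 ->
         forall u, 0 < u <= T n -> h1 u = h2 u).
Proof.
move=> h1 h12 h2 h14 g0; exists (fun n => n.+1%:R); split.
  by have := @cvgr_idn R; rewrite -cvg_shiftS.
move=> n; split; first exact: ltr0Sn.
exact: solves_eq_wellposed (ltr0Sn _ _).
Qed.
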